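(* Let $G\le\mathrm{Aut}(T)$ be a finitely generated branch group, and let $H$ be a group of homeomorphisms of strongly bounded type of a totally disconnected compact space $X$. Let $\rho:G\to H$ be an injective homomorphism, and let $Y\subset X$ be the essential support of the $G$-action on $X$ induced by $\rho$. Then there exists a continuous $G$-equivariant map $q:Y\to\partial T$.
   Context: $T$ is an infinite locally finite rooted tree, $\partial T$ its boundary; $\mathrm{Rist}_G(n)$ is the subgroup generated by the groups $\mathrm{Rist}_G(v)$ (elements acting trivially outside the subtree below $v$), $v$ at level $n$. $G$ is branch if it is transitive on each level and $\mathrm{Rist}_G(n)$ has finite index for all $n\ge1$. For $K$ acting on $X$, $\mathrm{supp}_X(K)$ is the closure of the set of non-fixed points; the essential support is $Y=\bigcap_{n\ge1}\mathrm{supp}_X(\mathrm{Rist}_G(n)')$, $K'$ denoting the derived subgroup. A Bratteli diagram consists of finite non-empty sets $(V_n)_{n\ge0}$, $(E_n)_{n\ge1}$ and surjections $\mathrm{o}:E_n\to V_{n-1}$, $\mathrm{t}:E_n\to V_n$; its path space $X_B$ is the set of infinite paths $e_1e_2\cdots$ with $e_i\in E_i$, $\mathrm{t}(e_i)=\mathrm{o}(e_{i+1})$, with the product topology. For a finite path $\gamma=e_1\cdots e_n$ set $\mathrm{t}(\gamma)=\mathrm{t}(e_n)$, let $C_\gamma$ be the cylinder of infinite paths starting with $\gamma$, and for $v\in V_n$ let $\mathcal{L}(v)$ be the set of finite paths ending at $v$. For $\gamma,\eta\in\mathcal{L}(v)$ the prefix replacement $F_{\gamma,\eta}:C_\gamma\to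 C_\eta$ is $\gamma e_{n+1}e_{n+2}\cdots\mapsto\eta e_{n+1}e_{n+2}\cdots$. For a homeomorphism $g$ of $X_B$, $x$ is a singularity of $g$ if the germ of $g$ at $x$ is not the germ of any prefix replacement; $A_v(g)$ is the number of $\gamma\in\mathcal{L}(v)$ such that $g|_{C_\gamma}$ is not a prefix replacement; $g$ is of bounded type if it has finitely many singularities and $\sup_vA_v(g)<\infty$. A group $H$ of homeomorphisms of $X_B$ is of strongly bounded type if it consists of homeomorphisms of bounded type and for every $x$ the isotropy group $H_x/H^0_x$ is locally finite ($H_x$ the stabilizer, $H^0_x$ the elements acting trivially near $x$). A group of homeomorphisms of a totally disconnected compact space $X$ is of strongly bounded type if some homeomorphism $X\cong X_B$ conjugates it to a group of strongly bounded type. *)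

(* Defs.v *)
From HB Require Import structures.
From mathcomp Require Import all_boot.
From mathcomp Require Import boolp classical_sets topology.
From Stdlib Require List.
Set Implicit Arguments. Unset Strict Implicit. Unset Printing Implicit Defensive.
Local Open Scope classical_set_scope.

Inductive gen_grp {A : Type} (S : (A -> A) -> Prop) : (A -> A) -> Prop :=
| gen_id : gen_grp S id
| gen_in : forall s, S s -> gen_grp S s
| gen_mul : forall s t, gen_grp S s -> gen_grp S t -> gen_grp S (s \o t)
| gen_inv : forall s s', gen_grp S s -> cancel s s' -> cancel s' s ->
    gen_grp S s'.

Definition is_perm_group {A : Type} (G : (A -> A) -> Prop) : Prop :=
  [/\ G id,
      (forall g h, G g -> G h -> G (g \o h)) &
      (forall g, G g -> exists2 g', G g' & cancel g g' /\ cancel g' g)].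

Definition derived {A : Type} (K : (A -> A) -> Prop) : (A -> A) -> Prop :=
  gen_grp (fun c => exists a a' b b', [/\ K a, K b,
     cancel a a' /\ cancel a' a, cancel b b' /\ cancel b' b &
     c = a' \o b' \o a \o b]).

(* Locally finite rooted trees.  Up to isomorphism, every locally finite    *)
(* rooted tree is T(deg): vertices are the words s over nat such that each   *)
(* letter s_i is < deg (s_0 ... s_{i-1}); the root is [::], and the children *)
(* of s are rcons s i, i < deg s.  The level of s is size s.                 *)

Fixpoint isv (deg : seq nat -> nat) (pre s : seq nat) : bool :=
  if s is a :: s' then (a < deg pre) && isv deg (rcons pre a) s' else true.

Definition vertex (deg : seq nat -> nat) (s : seq nat) : bool := isv deg [::] s.

Definition vert (deg : seq nat -> nat) := {s : seq nat | vertex deg s}.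

Definition tree_infinite (deg : seq nat -> nat) : Prop :=
  ~ exists l : seq (seq nat), forall s, vertex deg s -> s \in l.

Definition is_prefix (u w : seq nat) : bool := take (size u) w == u.

Definition adjacent (u w : seq nat) : bool :=
  ((size w == (size u).+1) && is_prefix u w) ||
  ((size u == (size w).+1) && is_prefix w u).

Definition is_aut (deg : seq nat -> nat) (g : vert deg -> vert deg) : Prop :=
  [/\ bijective g,
      (forall r : vert deg, val r = [::] -> val (g r) = [::]) &
      (forall u w : vert deg, adjacent (val u) (val w) = adjacent (val (g u)) (val (g w)))].

Definition bnd (deg : seq nat -> nat) :=
  {x : nat -> nat | forall n, vertex deg (mkseq x n)}.

Definition bpref (deg : seq nat -> nat) (x : bnd deg) (n : nat) : vert deg :=
  exist _ (mkseq (proj1_sig x) n) (proj2_sig x n).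

(* action of a tree automorphism on the boundary: the n-th letter of g.x is
   the last letter of g(x|_{n+1}) *)
Definition bact (deg : seq nat -> nat) (g : vert deg -> vert deg) (x : bnd deg)
  : nat -> nat := fun n => nth 0 (val (g (bpref x n.+1))) n.

Definition rist_v (deg : seq nat -> nat) (G : (vert deg -> vert deg) -> Prop)
  (v : vert deg) : (vert deg -> vert deg) -> Prop :=
  fun g => G g /\ forall w : vert deg, ~~ is_prefix (val v) (val w) -> g w = w.

Definition rist_n (deg : seq nat -> nat) (G : (vert deg -> vert deg) -> Prop)
  (n : nat) : (vert deg -> vert deg) -> Prop :=
  gen_grp (fun g => exists v : vert deg, size (val v) = n /\ rist_v G v g).

Definition finite_index {A : Type} (G K : (A -> A) -> Prop) : Prop :=
  exists R : list (A -> A), forall g, G g ->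
    exists r, List.In r R /\ exists k, K k /\ g = r \o k.

Definition fin_gen {A : Type} (G : (A -> A) -> Prop) : Prop :=
  exists S : list (A -> A), (forall s, List.In s S -> G s) /\
    forall g, G g <-> gen_grp (fun s => List.In s S) g.

Definition fg_branch_group (deg : seq nat -> nat)
  (G : (vert deg -> vert deg) -> Prop) : Prop :=
  [/\ is_perm_group G, (forall g, G g -> is_aut g), fin_gen G,
      (forall u w : vert deg, size (val u) = size (val w) ->
          exists2 g, G g & g u = w) &
      (forall n, 1 <= n -> finite_index G (rist_n G n))].

(* Bratteli diagrams, encoded with V_n = {0..bV n - 1} (n >= 0),             *)
(* E_n = {0..bE n - 1} (n >= 1), o = bo n : E_n -> V_{n-1},                  *)
(* t = bt n : E_n -> V_n.                                                    *)

Definition is_bratteli (bV bE : nat -> nat) (bo bt : nat -> nat -> nat) : Prop :=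
  [/\ (forall n, 0 < bV n),
      (forall n, 1 <= n -> 0 < bE n),
      (forall n e, 1 <= n -> e < bE n -> bo n e < bV n.-1 /\ bt n e < bV n),
      (forall n v, 1 <= n -> v < bV n.-1 -> exists2 e, e < bE n & bo n e = v) &
      (forall n v, 1 <= n -> v < bV n -> exists2 e, e < bE n & bt n e = v)].

Section Bratteli.
Variables (bV bE : nat -> nat) (bo bt : nat -> nat -> nat).

(* infinite paths e_1 e_2 ... ; the letter x i is the edge e_{i+1} in E_{i+1} *)
Definition bpath (x : nat -> nat) : Prop :=
  forall i, x i < bE i.+1 /\ bt i.+1 (x i) = bo i.+2 (x i.+1).

Definition fpath (g : seq nat) : Prop :=
  [/\ 1 <= size g,
      (forall i, i < size g -> nth 0 g i < bE i.+1) &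
      (forall i, i.+1 < size g -> bt i.+1 (nth 0 g i) = bo i.+2 (nth 0 g i.+1))].

Definition ftgt (g : seq nat) : nat := bt (size g) (nth 0 g (size g).-1).

Definition Lv (n v : nat) (g : seq nat) : Prop :=
  [/\ fpath g, size g = n & ftgt g = v].

Definition agree (m : nat) (x y : nat -> nat) : Prop :=
  forall i, i < m -> x i = y i.

Definition cyl (g : seq nat) (x : nat -> nat) : Prop :=
  bpath x /\ agree (size g) x (nth 0 g).

(* prefix replacement F_{gamma,eta} (used on C_gamma) *)
Definition prefrep (g e : seq nat) (x : nat -> nat) : nat -> nat :=
  fun i => if i < size g then nth 0 e i else x i.

(* x is a singularity of f : the germ of f at x is not the germ of any
   prefix replacement *)
Definition singular (f : (nat -> nat) -> (nat -> nat)) (x : nat -> nat) : Prop :=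
  ~ exists g e, [/\ fpath g, Lv (size g) (ftgt g) e, cyl g x &
      exists m, forall y, cyl g y -> agree m y x -> f y =1 prefrep g e y].

Definition is_prefrep_on (f : (nat -> nat) -> (nat -> nat)) (g : seq nat) : Prop :=
  exists e, Lv (size g) (ftgt g) e /\ forall y, cyl g y -> f y =1 prefrep g e y.

(* f is of bounded type: finitely many singularities, and
   sup_v A_v(f) < oo  (A_v(f) <= N expressed as: every duplicate-free list of
   gamma in L(v) with f|_{C_gamma} not a prefix replacement has size <= N) *)
Definition bounded_type (f : (nat -> nat) -> (nat -> nat)) : Prop :=
  (exists l : list (nat -> nat), forall x, bpath x -> singular f x -> List.In x l) /\
  (exists N, forall n v (s : seq (seq nat)), 1 <= n -> v < bV n -> uniq s ->
      (forall g, g \in s -> Lv n v g /\ ~ is_prefrep_on f g) -> size s <= N).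

End Bratteli.

Definition homeo {X : topologicalType} (h : X -> X) : Prop :=
  exists h', [/\ cancel h h', cancel h' h, continuous h & continuous h'].

Definition strongly_bounded {X : topologicalType} (H : (X -> X) -> Prop) : Prop :=
  exists bV bE bo bt (phi : X -> (nat -> nat)) (psi : (nat -> nat) -> X),
  let conj := fun (h : X -> X) (y : nat -> nat) => phi (h (psi y)) in
  let Hx := fun x h => H h /\ conj h x =1 x in
  let H0x := fun x h => H h /\ exists m, forall y, bpath bE bo bt y ->
                     agree m y x -> conj h y =1 y in
  [/\ is_bratteli bV bE bo bt,
      (* phi is a homeomorphism X -> X_B with inverse psi *)
      [/\ (forall x, bpath bE bo bt (phi x)),
      (forall x, psi (phi x) = x),
      (forall y, bpath bE bo bt y -> phi (psi y) =1 y),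
      (forall x n, \forall x' \near x, agree n (phi x') (phi x)) &
      (forall y, bpath bE bo bt y -> forall U, nbhs (psi y) U ->
          exists m, forall y', bpath bE bo bt y' -> agree m y' y -> U (psi y'))],
      (forall h, H h -> bounded_type bV bE bo bt (conj h)) &
      (* isotropy groups H_x / H_x^0 are locally finite *)
      (forall x, bpath bE bo bt x ->
         forall S : list (X -> X), (forall s, List.In s S -> Hx x s) ->
         exists R : list (X -> X), forall w, gen_grp (fun s => List.In s S) w ->
           exists r, List.In r R /\ exists k, H0x x k /\ w = r \o k)].

Definition supp {X : topologicalType} {A : Type} (rho : A -> (X -> X))
  (K : A -> Prop) : set X :=
  closure [set x | exists k, K k /\ rho k x <> x].

Definition ess_supp {X : topologicalType} (deg : seq nat -> nat)
  (G : (vert deg -> vert deg) -> Prop) (rho : (vert deg -> vert deg) -> (X -> X))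
  : set X :=
  [set x | forall n, 1 <= n -> supp rho (derived (rist_n G n)) x].

(* q : Y -> dT is continuous (dT with the product topology of discrete spaces,
   Y with the subspace topology) *)
Definition cont_to_bnd {X : topologicalType} (deg : seq nat -> nat) (Y : set X)
  (q : X -> bnd deg) : Prop :=
  forall y, Y y -> forall n, exists2 U, nbhs y U &
    forall y', U y' -> Y y' -> forall i, i < n -> proj1_sig (q y') i = proj1_sig (q y) i.

(* Main.v *)
(* For x in the essential support, let the rays xi with x in the support of
   Rist(xi_m)' for all m be called the rays of x. Koenig's lemma provides one, and
   uniqueness gives equivariance and continuity, so the point is uniqueness.

   In a group of bounded type, all but boundedly many cylinders of a level are
   moved by prefix replacements under a given finite set of generators. Hence the
   points cofinal to a given one meet only finitely many infinite orbits of a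
   finitely generated subgroup L, and if K is finitely generated and commutes with
   L, and Lx is infinite, then a finite index subgroup of K maps x into Lx.
   Moreover an element fixing x and commuting with L has trivial germ at x, because
   it fixes a regular point of Lx. Thus, for three pairwise commuting subgroups
   K, L, M with Lx and Mx infinite, a finite index subgroup K1 of K agrees near x
   with elements of L and with elements of M, so K1' is trivial near x.

   Let x have two rays xi and eta, separated at level n. Local finiteness of the
   isotropy groups shows that all groups Rist(xi_m) and Rist(eta_m) have infinite
   orbits at x. A third commuting rigid stabilizer is a conjugate of some
   Rist(xi_m), and the double commutator trick then puts x outside the support of
   Rist(xi_p)' for some p, a contradiction. *)

Require Import Defs.
From mathcomp Require Import all_boot.
From mathcomp Require Import boolp classical_sets topology cardinality.

Set Implicit Arguments.
Unset Strict Implicit.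
Unset Printing Implicit Defensive.

Local Open Scope classical_set_scope.

(** * Permutation groups *)

Lemma In_mem (T : eqType) (x : T) (l : seq T) : List.In x l <-> x \in l.
Proof.
elim: l => [|y l IH]; first by split.
rewrite /= inE; split.
  by case=> [->|/IH ->]; rewrite ?eqxx ?orbT.
by case/orP => [/eqP ->|/IH]; [left|right].
Qed.

Lemma finite_set_In (T : choiceType) (l : seq T) :
  finite_set [set x | List.In x l].
Proof.
by apply: sub_finite_set (finite_seq l) => x /In_mem.
Qed.

Lemma finite_set_seq (T : choiceType) (P : set T) :
  finite_set P -> exists l : seq T, forall x, P x <-> x \in l.
Proof. by case/finite_seqP => l ->; exists l => x; split. Qed.

Section Groups.
Variable A : choiceType.
Implicit Types (G K L S : set (A -> A)) (f g h k : A -> A).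

(** Inversion as a total operation by choice, with default value [y]; the value is meaningful where
    a two-sided inverse is known, as for members of a permutation group. *)
Definition invf g : A -> A := fun y => xget y [set x | g x = y].

Lemma invf_unique g g' : cancel g g' -> cancel g' g -> invf g = g'.
Proof.
move=> c c'; apply/funext => y; rewrite /invf.
have /= e : [set x | g x = y] (xget y [set x | g x = y]).
  by apply: (@xgetPex _ y); exists (g' y); rewrite /= c'.
by rewrite -(c (xget _ _)) e.
Qed.

Lemma invf_id : invf id = id.
Proof. exact: invf_unique. Qed.

Section PermGroup.
Variables (G : set (A -> A)) (GG : is_perm_group G).

Lemma grp_id : G id. Proof. by case: GG. Qed.

Lemma grp_mul g h : G g -> G h -> G (g \o h). Proof. by case: GG => _ + _; apply. Qed.

Lemma grp_invP g : G g -> [/\ G (invf g), cancel g (invf g) & cancel (invf g) g].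
Proof. by case: GG => _ _ /[apply] -[g' Gg' [c c']]; rewrite (invf_unique c c'). Qed.

Lemma grp_inv g : G g -> G (invf g). Proof. by case/grp_invP. Qed.
Lemma invfK g : G g -> cancel g (invf g). Proof. by case/grp_invP. Qed.
Lemma invfKV g : G g -> cancel (invf g) g. Proof. by case/grp_invP. Qed.

Lemma grp_conj z a : G z -> G a -> G (invf z \o a \o z).
Proof. by move=> Gz Ga; apply: grp_mul => //; apply: grp_mul => //; exact: grp_inv. Qed.

Lemma grp_comm a b : G a -> G b -> G (invf a \o invf b \o a \o b).
Proof.
move=> Ga Gb; apply: grp_mul => //; apply: grp_mul => //.
by apply: grp_mul; exact: grp_inv.
Qed.

Lemma invfM g h : G g -> G h -> invf (g \o h) = invf h \o invf g.
Proof.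
by move=> Gg Gh; apply: invf_unique => x /=; rewrite ?invfK // ?invfKV.
Qed.

Lemma invfV g : G g -> invf (invf g) = g.
Proof. by move=> Gg; apply: invf_unique => x; rewrite ?invfK ?invfKV. Qed.

Lemma invf_conj z a : G z -> G a -> invf (invf z \o a \o z) = invf z \o invf a \o z.
Proof.
by move=> Gz Ga; apply: invf_unique => x /=; rewrite ?invfKV ?invfK // invfKV.
Qed.

Lemma invf_comp_id g : G g -> invf g \o g = id.
Proof. by move=> Gg; apply/funext => x /=; rewrite invfK. Qed.

Lemma comp_invf_id g : G g -> g \o invf g = id.
Proof. by move=> Gg; apply/funext => x /=; rewrite invfKV. Qed.

Lemma gen_grp_sub S : S `<=` G -> gen_grp S `<=` G.
Proof.
move=> SG g; elim => {g}.
- exact: grp_id.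
- exact: SG.
- by move=> s t _ Gs _ Gt; apply: grp_mul.
- by move=> s s' _ Gs c c'; rewrite -(invf_unique c c'); exact: grp_inv.
Qed.

Lemma gen_grp_perm S : S `<=` G -> is_perm_group (gen_grp S).
Proof.
move=> SG; split; [exact: gen_id|by move=> *; exact: gen_mul|].
move=> g Hg; have Gg := gen_grp_sub SG Hg.
exists (invf g); last by split; [apply: invfK|apply: invfKV].
by apply: gen_inv Hg _ _; [apply: invfK|apply: invfKV].
Qed.

Lemma derived_sub K : K `<=` G -> derived K `<=` G.
Proof.
move=> KG; apply: gen_grp_sub => c [a [a' [b [b' [Ka Kb [ca ca'] [cb cb'] ->]]]]].
rewrite -(invf_unique ca ca') -(invf_unique cb cb').
by apply: grp_comm; apply: KG.
Qed.

Lemma derived_perm K : K `<=` G -> is_perm_group (derived K).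
Proof.
move=> KG; apply: gen_grp_perm => c Hc; apply: (derived_sub KG); exact: gen_in.
Qed.

Lemma derived_comm K a b : K `<=` G -> K a -> K b ->
  derived K (invf a \o invf b \o a \o b).
Proof.
move=> KG /[dup] Ka /KG Ga /[dup] Kb /KG Gb; apply: gen_in.
exists a, (invf a), b, (invf b); split=> //.
  by split; [apply: invfK|apply: invfKV].
by split; [apply: invfK|apply: invfKV].
Qed.

End PermGroup.

Lemma derived_min G K L : is_perm_group G -> K `<=` G -> is_perm_group L ->
  (forall a b, K a -> K b -> L (invf a \o invf b \o a \o b)) -> derived K `<=` L.
Proof.
move=> GG KG LL HL; apply: gen_grp_sub => // c.
case=> [a [a' [b [b' [Ka Kb [ca ca'] [cb cb'] ->]]]]].
by rewrite -(invf_unique ca ca') -(invf_unique cb cb'); apply: HL.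
Qed.

(** * Finite generation by words without inverses *)

Inductive mon S : set (A -> A) :=
| mon_id : mon S id
| mon_step s g : S s -> mon S g -> mon S (s \o g).

Lemma mon_mul S g h : mon S g -> mon S h -> mon S (g \o h).
Proof.
move=> Hg Hh; elim: Hg => // s k Ss _ IH.
exact: (@mon_step S s (k \o h)).
Qed.

Lemma mon_in S s : S s -> mon S s.
Proof. by move=> Ss; exact: (mon_step Ss (mon_id _)). Qed.

Lemma monS S S' : S `<=` S' -> mon S `<=` mon S'.
Proof.
by move=> SS' g; elim=> [|s h /SS' Ss _ IH]; [exact: mon_id|exact: mon_step].
Qed.

(** Generation as a monoid: induction on words only ever adds one generator on the left. For groups
    it follows from finite generation, by closing the generators under inversion. *)
Definition fin_gen_mon K :=
  exists S, [/\ finite_set S, S `<=` K & K `<=` mon S].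

Lemma fin_gen_monP G : is_perm_group G -> fin_gen G -> fin_gen_mon G.
Proof.
move=> GG [l [lG Gl]]; pose S := [set s | List.In s l].
exists (S `|` (invf @` S)); split.
- by rewrite finite_setU; split; [|apply: finite_image]; exact: finite_set_In.
- by move=> s [/lG//|[t /lG Gt <-]]; exact: grp_inv.
move=> g /Gl; have SG : S `<=` G by move=> s /lG.
suff H : gen_grp S `<=` [set g | [/\ G g, mon (S `|` invf @` S) g &
    mon (S `|` invf @` S) (invf g)]] by move/H => -[].
move=> {}g; elim=> {g}.
- split; [exact: grp_id|exact: mon_id|rewrite invf_id; exact: mon_id].
- move=> s Ss; split; first exact: SG.
    by apply: mon_in; left.
  by apply: mon_in; right; exists s.
- move=> s t _ [Gs ms ms'] _ [Gt mt mt']; split; first exact: grp_mul.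
    exact: mon_mul.
  by rewrite (invfM GG) //; exact: mon_mul.
- move=> s s' _ [Gs ms ms'] c c'; rewrite -(invf_unique c c').
  by split; rewrite ?(invfV GG) //; exact: grp_inv.
Qed.

(* Finite index, in the form: the left cosets of [K] meeting [G] are separated
   by a function with finitely many values on [G]. *)
Definition fin_index G K := exists (T : choiceType) (f : (A -> A) -> T),
  finite_set (f @` G) /\
  forall g h, G g -> G h -> f g = f h -> K (invf g \o h).

Lemma fin_indexP G K : is_perm_group G -> is_perm_group K -> K `<=` G ->
  finite_index G K -> fin_index G K.
Proof.
move=> GG KK KG [R HR].
pose f g := xget (@id A) [set r | List.In r R /\ exists k, K k /\ g = r \o k].
have fP g : G g -> List.In (f g) R /\ exists k, K k /\ g = f g \o k.
  move=> /HR [r Hr].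
  by apply: (@xgetPex _ (@id A) [set r | List.In r R /\ exists k, K k /\ g = r \o k]); exists r.
exists (A -> A), f; split.
  by apply: sub_finite_set (finite_set_In R) => _ [g /fP [? _] <-].
move=> g h Gg Gh efg.
have [_ [k [Kk eg]]] := fP g Gg; have [_ [k' [Kk' eh]]] := fP h Gh.
suff -> : invf g \o h = invf k \o k' by apply: grp_mul => //; exact: grp_inv.
have -> : h = g \o (invf k \o k').
  rewrite {1}eh -efg {2}eg; apply/funext => x /=.
  by rewrite (invfKV KK).
by apply/funext => x /=; rewrite (invfK GG).
Qed.

Lemma fin_indexS G K L : K `<=` L -> fin_index G K -> fin_index G L.
Proof.
move=> KL [T [f [fin Hf]]]; exists T, f; split=> // g h Gg Gh e.
exact/KL/Hf.
Qed.

Lemma fin_index_self G : is_perm_group G -> fin_index G G.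
Proof.
move=> GG; exists unit, (fun=> tt); split.
  by apply: sub_finite_set (finite_set1 tt) => -[].
by move=> g h Gg Gh _; apply: grp_mul => //; exact: grp_inv.
Qed.

Lemma fin_indexI G K L : fin_index G K -> fin_index G L -> fin_index G (K `&` L).
Proof.
move=> [T [f [fin Hf]]] [T' [f' [fin' Hf']]].
exists (T * T')%type, (fun g => (f g, f' g)); split.
  apply: sub_finite_set (finite_setX fin fin') => _ [g Gg <-].
  by split; exists g.
by move=> g h Gg Gh [e e']; split; [apply: Hf|apply: Hf'].
Qed.

Lemma fin_index_all (I : eqType) G (F : I -> set (A -> A)) (l : seq I) :
  is_perm_group G -> (forall i, i \in l -> fin_index G (F i)) ->
  fin_index G [set a | G a /\ forall i, i \in l -> F i a].
Proof.
move=> GG; elim: l => [|i l IH] HF.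
  by apply: fin_indexS (fin_index_self GG).
apply: (@fin_indexS _ (F i `&` [set a | G a /\ forall i, i \in l -> F i a])).
  by move=> a [Fi [Ga Fl]]; split=> // j; rewrite inE => /orP[/eqP->|/Fl].
apply: fin_indexI; first by apply: HF; rewrite inE eqxx.
by apply: IH => j jl; apply: HF; rewrite inE jl orbT.
Qed.

Lemma fin_index_sub G K L : is_perm_group L -> L `<=` G -> fin_index G K ->
  fin_index L (K `&` L).
Proof.
move=> LL LG [T [f [fin Hf]]]; exists T, f; split.
  by apply: sub_finite_set fin => _ [g /LG Gg <-]; exists g.
move=> g h Lg Lh e; split; first by apply: Hf => //; apply: LG.
by apply: grp_mul => //; exact: grp_inv.
Qed.

Lemma fin_index_reps G K : is_perm_group G -> is_perm_group K -> K `<=` G ->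
  fin_index G K -> exists l : seq (A -> A), (forall r, r \in l -> G r) /\
    forall g, G g -> exists2 r, r \in l & K (invf r \o g).
Proof.
move=> GG KK KG [T [f [fin Hf]]].
pose rep t := xget (@id A) [set g | G g /\ f g = t].
have repP g : G g -> G (rep (f g)) /\ f (rep (f g)) = f g.
  by move=> Gg; apply: (@xgetPex _ (@id A) [set h | G h /\ f h = f g]); exists g.
have /finite_set_seq [l Hl] := finite_image rep fin.
exists l; split=> [r /Hl [_ [g Gg <-] <-]|g Gg]; first by case: (repP _ Gg).
exists (rep (f g)); first by apply/Hl; exists (f g) => //; exists g.
by have [Gr e] := repP _ Gg; apply: Hf.
Qed.

(** The separating datum of [g] is a representative [r] of its coset modulo [K], together with the
    datum of [r^-1 g] for [L] in [K]. *)
Lemma fin_index_trans G K L : is_perm_group G -> is_perm_group K -> K `<=` G ->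
  fin_index G K -> fin_index K L -> fin_index G L.
Proof.
move=> GG KK KG iK [T [f [fin Hf]]].
have [l [lG Hl]] := fin_index_reps GG KK KG iK.
pose rep g := xget (@id A) [set r | r \in l /\ K (invf r \o g)].
have repP g : G g -> rep g \in l /\ K (invf (rep g) \o g).
  move=> Gg; apply: (@xgetPex _ (@id A) [set r | r \in l /\ K (invf r \o g)]).
  by case: (Hl g Gg) => r ? ?; exists r.
exists ((A -> A) * T)%type, (fun g => (rep g, f (invf (rep g) \o g))); split.
  apply: sub_finite_set (finite_setX (finite_seq l) fin) => _ [g /repP [rl Kr] <-].
  by split=> //; exists (invf (rep g) \o g).
move=> g h Gg Gh [er ef].
have [rl Kg] := repP _ Gg; have [_ Kh] := repP _ Gh.
have := Hf _ _ Kg Kh ef; rewrite -er.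
have Gr := lG _ rl; have Gr' := grp_inv GG Gr.
rewrite (invfM GG) // (invfV GG) //.
congr (L _); apply/funext => x /=; by rewrite (invfKV GG).
Qed.

(** * Normal cores and Schreier's lemma *)

Definition core G K := [set a | G a /\ forall z, G z -> K (invf z \o a \o z)].

Lemma core_sub G K : is_perm_group G -> core G K `<=` K.
Proof.
by move=> GG a [Ga /(_ id (grp_id GG))]; rewrite invf_id.
Qed.

Lemma core_perm G K : is_perm_group G -> is_perm_group K -> is_perm_group (core G K).
Proof.
move=> GG KK; split.
- split; first exact: grp_id.
  by move=> z Gz; rewrite (_ : _ \o z = id) ?(invf_comp_id GG) //; exact: grp_id.
- move=> a b [Ga Ha] [Gb Hb]; split; first exact: grp_mul.
  move=> z Gz; have := grp_mul KK (Ha _ Gz) (Hb _ Gz).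
  congr (K _); apply/funext => x /=; by rewrite (invfKV GG).
- move=> a [Ga Ha]; exists (invf a); last first.
    by split; [apply: (invfK GG)|apply: (invfKV GG)].
  split; first exact: grp_inv.
  move=> z Gz; have := grp_inv KK (Ha _ Gz).
  by rewrite (invf_conj GG).
Qed.

Lemma core_normal G K a z : is_perm_group G -> G z -> core G K a ->
  core G K (invf z \o a \o z).
Proof.
move=> GG Gz [Ga Ha]; split.
  exact: grp_conj.
move=> y Gy; have := Ha (z \o y) (grp_mul GG Gz Gy).
by rewrite (invfM GG).
Qed.

(** Finitely many conjugates suffice: if [z = r k] with [k] in [K], then
    [z^-1 a z = k^-1 (r^-1 a r) k], so it is enough to let [r] run over coset representatives. The
    map separating cosets of [K], composed with conjugation by [r], handles each of them. *)
Lemma fin_index_core G K : is_perm_group G -> is_perm_group K -> K `<=` G ->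
  fin_index G K -> fin_index G (core G K).
Proof.
move=> GG KK KG iK; have [l [lG Hl]] := fin_index_reps GG KK KG iK.
apply: (@fin_indexS _ [set a | G a /\ forall r, r \in l -> K (invf r \o a \o r)]).
  move=> a [Ga Ha]; split=> // z Gz; have [r rl Kr] := Hl _ Gz.
  have Gr := lG _ rl; set k := invf r \o z in Kr.
  have -> : invf z \o a \o z = invf k \o (invf r \o a \o r) \o k.
    rewrite (invfM GG (grp_inv GG Gr) Gz) (invfV GG) //.
    by apply/funext => x; rewrite /k /= !(invfKV GG).
  by apply: (grp_mul KK) => //; apply: (grp_mul KK); [exact: (grp_inv KK)|exact: Ha].
apply: fin_index_all => // r rl; have Gr := lG _ rl.
case: iK => T [f [fin Hf]]; exists T, (fun a => f (invf r \o a \o r)); split.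
  apply: sub_finite_set fin => _ [a Ga <-]; exists (invf r \o a \o r) => //.
  exact: grp_conj.
move=> g h Gg Gh /Hf e.
have Gc a : G a -> G (invf r \o a \o r).
  by move=> Ga; exact: grp_conj.
have {e} := e (Gc _ Gg) (Gc _ Gh); congr (K _).
rewrite (invf_conj GG) //.
by apply/funext => x /=; rewrite (invfKV GG).
Qed.

(** Schreier's lemma. Moving a representative leftwards through a word by [s r = r' (r'^-1 s r)]
    leaves a representative times a product of Schreier generators. The identity need not be among
    the representatives, so those lying in [K], and the inverses of representatives that lie in [K],
    join the generators. *)
Lemma schreier_fin_gen G K : is_perm_group G -> is_perm_group K -> K `<=` G ->
  fin_gen_mon G -> fin_index G K -> fin_gen_mon K.
Proof.
move=> GG KK KG [S [finS SG GS]] iK.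
have [l [lG Hl]] := fin_index_reps GG KK KG iK.
pose SK := K `&` [set t | exists s r r', [/\ S s, r \in l, r' \in l &
   t = invf r' \o s \o r]].
pose LK := K `&` ([set` l] `|` invf @` [set` l]).
have key g : mon S g -> forall r, r \in l ->
    exists2 r', r' \in l & exists2 k, mon SK k & g \o r = r' \o k.
  elim=> [|s {}g Ss _ IH] r rl; first by exists r => //; exists id => //; exact: mon_id.
  have [r1 r1l [k mk e]] := IH r rl.
  have [r2 r2l Kr2] := Hl (s \o r1) (grp_mul GG (SG _ Ss) (lG _ r1l)).
  exists r2 => //; exists ((invf r2 \o s \o r1) \o k).
    by apply: mon_step => //; split=> //; exists s, r1, r2.
  rewrite -[(s \o g) \o r]/(s \o (g \o r)) e; apply/funext => x /=.
  by rewrite (invfKV GG) //; exact: lG.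
have SKK : mon SK `<=` K.
  move=> k; elim=> [|s g [Ks _] _ Kg]; [exact: grp_id|exact: grp_mul].
exists (SK `|` LK); split.
- rewrite finite_setU; split.
    apply: (@sub_finite_set _ _ ((fun p => invf p.1 \o p.2.1 \o p.2.2) @`
       ([set` l] `*` (S `*` [set` l])))).
      by move=> t [_ [s [r [r' [Ss rl r'l ->]]]]]; exists (r', (s, r)).
    apply: finite_image; apply: finite_setX; first exact: finite_seq.
    by apply: finite_setX => //; exact: finite_seq.
  apply: (@sub_finite_set _ _ ([set` l] `|` invf @` [set` l])); first by move=> t [].
  by rewrite finite_setU; split; [|apply: finite_image]; exact: finite_seq.
- by move=> t [[]|[]].
(* [r0] represents the coset of the identity, hence lies in [K]; the word is pushed through it and
   it is divided out at the end. *)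
move=> k Kk; have [r0 r0l Kr0] := Hl id (grp_id GG).
have Gr0 := lG _ r0l.
have {}Kr0 : K (invf r0) by [].
have Kr0' : K r0 by rewrite -(invfV GG Gr0); exact: grp_inv.
have [r r'l [k1 mk1 e]] := key k (GS _ (KG _ Kk)) _ r0l.
have Kr : K r.
  have -> : r = (k \o r0) \o invf k1.
    by rewrite e; apply/funext => x /=; rewrite (invfKV KK) //; exact: SKK.
  apply: grp_mul => //; first exact: grp_mul.
  by apply: grp_inv => //; exact: SKK.
have -> : k = r \o (k1 \o invf r0).
  rewrite -[RHS]/((r \o k1) \o invf r0) -e; apply/funext => x /=.
  by rewrite (invfKV GG).
apply: mon_step; first by right; split=> //; left.
apply: mon_mul; first by apply: monS mk1; exact: subsetUl.
by apply: mon_in; right; split=> //; right; exists r0.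
Qed.

End Groups.

Lemma derivedS (A : Type) (K L : (A -> A) -> Prop) :
  K `<=` L -> derived K `<=` derived L.
Proof.
move=> KL g; elim=> {g}.
- exact: gen_id.
- move=> c [a [a' [b [b' [Ka Kb ca cb ->]]]]]; apply: gen_in.
  by exists a, a', b, b'; split=> //; exact: KL.
- by move=> s t _ Ds _ Dt; exact: gen_mul.
- by move=> s s' _ Ds c c'; exact: gen_inv c c'.
Qed.

Lemma derived_conj (A : choiceType) (G K L : set (A -> A)) g :
  is_perm_group G -> K `<=` G -> G g ->
  (forall a, K a -> L (g \o a \o invf g)) ->
  forall k, derived K k -> derived L (g \o k \o invf g).
Proof.
move=> GG KG Gg KL k; have gK := invfK GG Gg; have gKV := invfKV GG Gg.
have cnj (s s' : A -> A) : cancel s s' -> cancel (g \o s \o invf g) (g \o s' \o invf g).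
  by move=> c x /=; rewrite gK c gKV.
elim=> {k}.
- by rewrite (_ : _ \o invf g = id) ?(comp_invf_id GG) //; exact: gen_id.
- move=> c [a [a' [b [b' [Ka Kb [ca ca'] [cb cb'] ->]]]]]; apply: gen_in.
  exists (g \o a \o invf g), (g \o a' \o invf g), (g \o b \o invf g), (g \o b' \o invf g).
  split; [exact: KL|exact: KL|by split; exact: cnj|by split; exact: cnj|].
  by apply/funext => x /=; rewrite !gK.
- move=> s t _ Ds _ Dt.
  rewrite (_ : _ \o invf g = (g \o s \o invf g) \o (g \o t \o invf g)).
    exact: gen_mul.
  by apply/funext => x /=; rewrite gK.
- by move=> s s' _ Ds c c'; apply: gen_inv Ds _ _; exact: cnj.
Qed.

(** * Rigid stabilizers *)

Section Trees.
Variable deg : seq nat -> nat.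
Notation V := (vert deg).
Implicit Types (u v w z : V) (g h k : V -> V).

Lemma isv_cat p s t : isv deg p (s ++ t) = isv deg p s && isv deg (p ++ s) t.
Proof.
elim: s p => [|a s IH] p /=; first by rewrite cats0.
by rewrite IH -andbA cat_rcons.
Qed.

Lemma vertex_take n s : vertex deg s -> vertex deg (take n s).
Proof.
by rewrite -{1}(cat_take_drop n s) /vertex isv_cat => /andP[].
Qed.

Lemma vertex_rcons s a : vertex deg (rcons s a) = vertex deg s && (a < deg s).
Proof. by rewrite /vertex -cats1 isv_cat /= andbT. Qed.

Definition mkv s (vs : vertex deg s) : V :=
  exist (fun s => is_true (vertex deg s)) s vs.

Definition trunc n v : V := exist _ (take n (val v)) (vertex_take n (valP v)).

Definition pre v w : bool := is_prefix (val v) (val w).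

Lemma preP v w : reflect (trunc (size (val v)) w = v) (pre v w).
Proof.
apply: (iffP eqP) => [e|e]; first exact: val_inj.
by rewrite -{2}e.
Qed.

Lemma pre_size v w : pre v w -> size (val v) <= size (val w).
Proof. by move/eqP => <-; rewrite size_take_min geq_minr. Qed.

Lemma pre_refl v : pre v v. Proof. by apply/eqP; rewrite take_size. Qed.

Lemma pre_trans v u w : pre u v -> pre v w -> pre u w.
Proof.
move=> /[dup] /pre_size le /eqP eu /eqP ev; apply/eqP.
by rewrite -{2}eu -ev take_takel.
Qed.

Lemma pre_trunc n v : pre (trunc n v) v.
Proof.
apply/eqP => /=; rewrite size_take_min; case: (leqP n (size (val v))) => // le.
by rewrite take_size take_oversize // ltnW.
Qed.

Lemma pre_eq u v w : size (val u) = size (val v) -> pre u w -> pre v w -> u = v.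
Proof. by move=> e /preP eu /preP ev; rewrite -eu -ev e. Qed.

Lemma pre_total u v w : size (val u) <= size (val v) -> pre u w -> pre v w -> pre u v.
Proof.
move=> le /eqP eu /eqP ev; apply/eqP; rewrite -{2}eu -ev take_takel //.
Qed.

Lemma size_trunc n v : n <= size (val v) -> size (val (trunc n v)) = n.
Proof. by move=> le /=; rewrite size_takel. Qed.

Section Automorphism.
Variables (g : V -> V) (Hg : is_aut g).

Let g_inj : injective g. Proof. by case: Hg => /bij_inj. Qed.

(** By induction on the level. The image of [u] is adjacent to that of its parent [p]; were it the
    parent of [g p], it would be the image of the parent of [p], against injectivity. *)
Let aut_parent n u : size (val u) = n ->
  size (val (g u)) = n /\ g (trunc n.-1 u) = trunc n.-1 (g u).
Proof.
case: Hg => _ groot gadj; elim: n u => [|n IH] u su.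
  have eu := size0nil su; have egu := groot _ eu.
  split; first by rewrite egu.
  have -> : trunc 0.-1 u = u by apply: val_inj; rewrite /= take0 eu.
  by apply: val_inj; rewrite /= take0 egu.
set p := trunc n u; have sp : size (val p) = n by rewrite size_trunc ?su.
have [sgp gp] := IH _ sp.
have := gadj p u; rewrite /adjacent sp su eqxx (pre_trunc n u : is_prefix _ _) /=.
rewrite sgp =>  /esym /orP[/andP[/eqP s1 /preP]|/andP[/eqP s1 /preP]].
  by rewrite sgp => e; split; [exact: s1|exact: (esym e)].
move=> e0; have e : g (trunc n.-1 p) = g u by rewrite gp s1; exact: e0.
move/g_inj: e => /(congr1 (fun v => size (val v))).
by rewrite su size_trunc ?sp ?leq_pred // => /eqP; rewrite ltn_eqF // ltnS leq_pred.
Qed.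

Lemma aut_size u : size (val (g u)) = size (val u).
Proof. by case: (aut_parent (erefl (size (val u)))). Qed.

Lemma aut_trunc n u : g (trunc n u) = trunc n (g u).
Proof.
have trunc_ge m v : size (val v) <= m -> trunc m v = v.
  by move=> le; apply: val_inj; rewrite /= take_oversize.
case: (leqP (size (val u)) n) => [le|/ltnW le].
  by rewrite !trunc_ge ?aut_size.
have [j] : exists j, j = size (val u) - n by eexists.
elim: j n le => [|j IH] n le ej.
  by rewrite !trunc_ge ?aut_size // -subn_eq0 -ej.
have lt : n < size (val u) by rewrite -subn_gt0 -ej.
have tt v : trunc n v = trunc n (trunc n.+1 v).
  by apply: val_inj; rewrite /= take_takel.
have s1 := size_trunc lt.
have [_] := aut_parent s1; rewrite /= -tt => ->.
rewrite (IH _ lt) -?tt //.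
by rewrite subnS -ej.
Qed.

Lemma aut_pre u w : pre (g u) (g w) = pre u w.
Proof.
apply/preP/preP; rewrite aut_size -aut_trunc; first by move/g_inj.
by move->.
Qed.

End Automorphism.

Lemma level_list n : exists2 l : seq V, uniq l & forall u, (u \in l) = (size (val u) == n).
Proof.
suff [l Hl] : exists l : seq (seq nat), forall s, vertex deg s -> size s = n -> s \in l.
  exists (undup [seq u <- pmap insub l | size (val u) == n]).
    exact: undup_uniq.
  move=> u; rewrite mem_undup mem_filter; case: eqP => //= su.
  rewrite mem_pmap_sub.
  exact: Hl (valP u) su.
elim: n => [|n [l Hl]].
  by exists [:: [::]] => s _ /size0nil ->; rewrite inE.
exists (flatten [seq [seq rcons p i | i <- iota 0 (deg p)] | p <- l]).
case/lastP => // s a; rewrite vertex_rcons => /andP[vs lt]; rewrite size_rcons => -[ss].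
apply/flattenP; exists [seq rcons s i | i <- iota 0 (deg s)].
  by apply/mapP; exists s => //; exact: Hl.
by apply/mapP; exists a => //; rewrite mem_iota add0n.
Qed.

Lemma size_bpref (x : bnd deg) n : size (val (bpref x n)) = n.
Proof. exact: size_mkseq. Qed.

Lemma trunc_bpref (x : bnd deg) m n : m <= n -> trunc m (bpref x n) = bpref x m.
Proof.
move=> le; apply: val_inj => /=; rewrite /mkseq -map_take take_iota.
by rewrite (minn_idPl le).
Qed.

Lemma pre_bpref (x : bnd deg) m n : m <= n -> pre (bpref x m) (bpref x n).
Proof. by move=> le; apply/preP; rewrite size_bpref trunc_bpref. Qed.

(** A vertex is [good] when [P] holds arbitrarily deep below it. Having finitely many children, a
    good vertex has a good child, and iteration from the root yields the ray. *)
Lemma koenig (P : V -> Prop) : (forall u w, pre u w -> P w -> P u) ->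
  (forall m, exists2 w, size (val w) = m & P w) ->
  exists x : bnd deg, forall m, P (bpref x m).
Proof.
move=> Pcl Pinf.
pose good u := forall m, exists w, [/\ pre u w, m <= size (val w) & P w].
pose root : V := exist _ [::] (isT : vertex deg [::]).
have good_root : good root.
  move=> m; have [w sw Pw] := Pinf m; exists w.
  by rewrite sw; split=> //; apply/eqP; rewrite /= take0.
have child u : good u -> exists w, [/\ good w, size (val w) = (size (val u)).+1 & pre u w].
  move=> gu; apply: contrapT => Hno.
  (* If no child is good, each letter [i] bounds the depth of [P] below the corresponding child;
     letters from [deg u] on name no child and get the bound 0. *)
  have Hb i : exists M, forall w, pre u w -> nth 0 (val w) (size (val u)) = i ->
      size (val u) < size (val w) -> P w -> size (val w) < M.
    case: (ltnP i (deg (val u))) => lti; last first.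
      exists 0 => w /preP ew ni lt Pw; exfalso.
      have := valP (trunc (size (val u)).+1 w); rewrite /= (take_nth 0) //.
      have -> : take (size (val u)) (val w) = val u by rewrite -{2}ew.
      by rewrite vertex_rcons ni ltnNge lti andbF.
    have vc : vertex deg (rcons (val u) i) by rewrite vertex_rcons (valP u).
    pose c := mkv vc.
    have /existsNP [M HM] : ~ good c.
      move=> gc; apply: Hno; exists c; split; rewrite //= ?size_rcons //.
      by apply/eqP; rewrite /= -cats1 take_size_cat.
    exists M => w /preP ew ni lt Pw; rewrite ltnNge; apply/negP => le; apply: HM.
    exists w; split=> //; apply/eqP; rewrite /= size_rcons (take_nth 0) // ni.
    by move/(congr1 val): ew => /= ->.
  have [B HB] := choice Hb.
  (* A descendant of level at least [M] lies strictly below [u] and violates the bound of the child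
     it passes through. *)
  pose M := maxn (\max_(i < deg (val u)) B i) (size (val u)).+1.
  have [w [uw]] := gu M; rewrite geq_max => /andP[le lt] Pw.
  have lti : nth 0 (val w) (size (val u)) < deg (val u).
    have := valP (trunc (size (val u)).+1 w); rewrite /= (take_nth 0) //.
    by move/eqP: uw => ->; rewrite vertex_rcons => /andP[].
  have := HB _ w uw erefl lt Pw.
  rewrite ltnNge (leq_trans _ le) //.
  exact: (@leq_bigmax _ (fun i : 'I_(deg (val u)) => B i) (Ordinal lti)).
have /choice [F HF] : forall u, exists w, good u ->
    [/\ good w, size (val w) = (size (val u)).+1 & pre u w].
  move=> u; case: (pselect (good u)) => [/child [w Hw]|nu]; first by exists w.
  by exists u.
pose s n := iter n F root.
have sP n : good (s n) /\ size (val (s n)) = n.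
  elim: n => [|n [gn sn]] //=; have [g1 s1 _] := HF _ gn.
  by rewrite s1 sn.
pose x n := nth 0 (val (s n.+1)) n.
have xs n : mkseq x n = val (s n).
  elim: n => [|n IH] //; rewrite mkseqS IH /x.
  have [gn sn] := sP n; have [_ _ /preP e] := HF _ gn; have [_ s1] := sP n.+1.
  have tk : take n.+1 (val (s n.+1)) = val (s n.+1) by rewrite take_oversize // s1.
  rewrite -[RHS]tk (take_nth 0) ?s1 //; congr (rcons _ _).
  by move/(congr1 val): e; rewrite sn => /= ->.
have xv i : vertex deg (mkseq x i) by rewrite xs; exact: valP.
pose xi : bnd deg := exist _ x xv; exists xi => m.
have -> : bpref xi m = s m by apply: val_inj; rewrite /= xs.
have [gm _] := sP m; have [w [+ _ Pw]] := gm 0.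
by move/Pcl; apply.
Qed.

(** If some level [m] were empty, all vertices would lie on the finitely many finite levels below
    [m]; otherwise [koenig] applies to the trivial property. *)
Lemma bnd_inhabited : tree_infinite deg -> exists x : bnd deg, True.
Proof.
move=> Tinf; suff [x _] : exists x : bnd deg, forall m, (fun=> True) (bpref x m) by exists x.
apply: (koenig (P := fun=> True)) => // m; apply: contrapT => Hno; apply: Tinf.
have Hlt s : vertex deg s -> size s < m.
  move=> vs; rewrite ltnNge; apply/negP => le; apply: Hno.
  by exists (trunc m (mkv vs)); rewrite //= size_takel.
suff [l Hl] : exists l : seq (seq nat), forall s, vertex deg s -> size s < m -> s \in l.
  by exists l => s vs; apply: Hl => //; exact: Hlt.
elim: m {Hno Hlt} => [|m [l Hl]]; first by exists [::].
have [l' _ Hl'] := level_list m; exists (l ++ map val l') => s vs.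
rewrite ltnS leq_eqVlt mem_cat => /orP[/eqP e|lt]; last by rewrite Hl.
by apply/orP; right; apply/mapP; exists (mkv vs); rewrite // Hl' /= e.
Qed.

Section RigidStabilizers.
Variables (G : (V -> V) -> Prop) (GG : is_perm_group G).
Hypothesis Gaut : forall g, G g -> is_aut g.

Lemma rist_sub v : rist_v G v `<=` G. Proof. by move=> g []. Qed.

Lemma rist_out v g w : rist_v G v g -> ~~ pre v w -> g w = w.
Proof. by case=> _; apply. Qed.

Lemma rist_pre v g w : rist_v G v g -> pre v (g w) = pre v w.
Proof.
move=> rg; have Gg := rist_sub rg.
case: (boolP (pre v w)) => [pw|npw]; last by rewrite (rist_out rg npw) (negbTE npw).
apply: contraT => npg; have e := rist_out rg npg.
by have := can_inj (invfK GG Gg) e => e2; rewrite -e2 in pw; rewrite pw in npg.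
Qed.

Lemma rist_perm v : is_perm_group (rist_v G v).
Proof.
split; first by split=> //; exact: grp_id.
- move=> g h rg rh; split; first by apply: grp_mul => //; apply: rist_sub; eassumption.
  by move=> w npw /=; rewrite (rist_out rh npw) (rist_out rg npw).
- move=> g rg; have Gg := rist_sub rg; exists (invf g); last first.
    by split; [exact: (invfK GG)|exact: (invfKV GG)].
  split; first exact: grp_inv.
  by move=> w npw; rewrite -{1}(rist_out rg npw) (invfK GG).
Qed.

Lemma rist_fix v g w : rist_v G v g -> size (val w) <= size (val v) -> g w = w.
Proof.
move=> rg le; case: (boolP (pre v w)) => pw; last exact: (rist_out rg).
have e : w = v.
  apply: (pre_eq _ (pre_refl w)) => //; apply/eqP; rewrite eqn_leq le.
  exact: pre_size.
rewrite e in pw *; have := rist_pre v rg; rewrite pw => /(pre_eq _ (pre_refl _)).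
by move=> -> //; rewrite aut_size //; exact/Gaut/rist_sub/rg.
Qed.

Lemma rist_mono u w : pre u w -> rist_v G w `<=` rist_v G u.
Proof.
move=> puw g rg; split; first exact: (rist_sub rg).
move=> z npz; apply: (rist_out rg); apply: contra npz; exact: pre_trans.
Qed.

Lemma rist_comm u w g h z : ~~ pre u w -> ~~ pre w u ->
  rist_v G u g -> rist_v G w h -> g (h z) = h (g z).
Proof.
move=> nuw nwu rg rh.
have disj y : pre u y -> ~~ pre w y.
  move=> puy; apply/negP => pwy.
  case/orP: (leq_total (size (val u)) (size (val w))) => le.
    by rewrite (pre_total le puy pwy) in nuw.
  by rewrite (pre_total le pwy puy) in nwu.
case: (boolP (pre u z)) => puz.
  rewrite (rist_out rh (disj _ puz)) (rist_out rh) //.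
  by apply: disj; rewrite (rist_pre _ rg).
rewrite (rist_out rg puz) (rist_out rg) //.
case: (boolP (pre w z)) => pwz; last by rewrite (rist_out rh pwz).
rewrite -(rist_pre _ rh) in pwz.
by apply/negP => /disj; rewrite pwz.
Qed.

Lemma rist_level_comm u w g h z : size (val u) = size (val w) -> u <> w ->
  rist_v G u g -> rist_v G w h -> g (h z) = h (g z).
Proof.
move=> e ne; apply: rist_comm; apply/negP => p; apply: ne.
  exact: pre_eq e p (pre_refl _).
exact: pre_eq e (pre_refl _) p.
Qed.

Lemma rist_conj a u g : G a -> rist_v G (a u) g -> rist_v G u (invf a \o g \o a).
Proof.
move=> Ga rg; split; first by apply: grp_conj => //; exact: rist_sub rg.
move=> w npw /=; rewrite (rist_out rg) ?(invfK GG) //.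
by rewrite aut_pre //; exact: Gaut.
Qed.

Lemma rist_conjV a u g : G a -> rist_v G u g -> rist_v G (a u) (a \o g \o invf a).
Proof.
move=> Ga rg; have := @rist_conj (invf a) (a u) g (grp_inv GG Ga).
by rewrite (invfK GG Ga) (invfV GG Ga); apply.
Qed.

Lemma rist_derived_perm v : is_perm_group (derived (rist_v G v)).
Proof. exact: derived_perm (@rist_sub v). Qed.

(* The double commutator trick: for [a] in [K] moving [u] and [b] in the rigid
   stabilizer of [u], the element [b (a^-1 b^-1 a)] of [K] acts on the subtree
   below [u] as [b] does. *)
Lemma rist_derived_sub (K : set (V -> V)) u a : is_perm_group K -> K `<=` G ->
  (forall g k, rist_v G u g -> K k -> K (invf g \o k \o g)) ->
  K a -> a u <> u -> derived (rist_v G u) `<=` K.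
Proof.
move=> KK KG Knorm Ka ne; have Ga := KG _ Ka; have Ga' := grp_inv GG Ga.
apply: (derived_min GG (@rist_sub u)) => // b c rb rc.
have Gb := rist_sub rb; have Gc := rist_sub rc; have Ru := rist_perm u.
have rb' := grp_inv Ru rb.
set u' := invf a u.
have ne' : u' <> u by rewrite /u' => e; apply: ne; rewrite -{1}e (invfKV GG).
have su : size (val u') = size (val u) by rewrite aut_size //; exact: Gaut.
pose beta := invf a \o invf b \o a.
have rbeta : rist_v G u' beta.
  by apply: rist_conj => //; rewrite /u' (invfKV GG).
have Gbeta := rist_sub rbeta.
pose t := b \o beta.
have Kt : K t.
  have := grp_mul KK (Knorm _ _ rb' (grp_inv KK Ka)) Ka.
  by rewrite (invfV GG).
have Gt := KG _ Kt.
(* This is the commutator of [t] and [c]. It equals that of [b] and [c], since [beta] lives below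
   [u'] and commutes with the rigid stabilizer of [u]. *)
have := grp_mul KK (grp_inv KK Kt) (Knorm _ _ rc Kt).
congr (K _); rewrite /t (invfM GG) //; apply/funext => z /=.
have cm h y : rist_v G u h -> beta (h y) = h (beta y).
  exact: (rist_level_comm _ su ne' rbeta).
have cm' h y : rist_v G u h -> invf beta (h y) = h (invf beta y).
  exact: (rist_level_comm _ su ne' (grp_inv (rist_perm u') rbeta)).
rewrite (cm _ _ rc) (cm' _ _ rb') (cm' _ _ (grp_inv Ru rc)) (cm' _ _ rb) (cm' _ _ rc).
by rewrite (invfK GG).
Qed.

(** On [rist_n G n] with [v] of level [n], this is the projection of the direct product of the rigid
    stabilizers of the level to the factor at [v]. *)
Definition restr v g : V -> V := fun w => if pre v w then g w else w.

Lemma restr_id v : restr v id = id.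
Proof. by apply/funext => w; rewrite /restr if_same. Qed.

Lemma restr_comp v g h : (forall w, pre v (h w) = pre v w) ->
  restr v (g \o h) = restr v g \o restr v h.
Proof.
move=> hp; apply/funext => w; rewrite /restr /=.
by case: (boolP (pre v w)) => p; rewrite ?hp ?p // (negbTE p).
Qed.

Lemma restr_rist v g : rist_v G v g -> restr v g = g.
Proof.
move=> rg; apply/funext => w; rewrite /restr.
by case: ifPn => // /(rist_out rg).
Qed.

Section Level.
Variables (n : nat).

Lemma rist_sub_n v : size (val v) = n -> rist_v G v `<=` rist_n G n.
Proof. by move=> sv g rg; apply: gen_in; exists v. Qed.

Let gens_sub : (fun g => exists v : vert deg, size (val v) = n /\ rist_v G v g) `<=` G.
Proof. by move=> g [v [_ /rist_sub]]. Qed.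

Lemma rist_n_sub : rist_n G n `<=` G.
Proof. exact: gen_grp_sub gens_sub. Qed.

Lemma rist_n_perm : is_perm_group (rist_n G n).
Proof. exact: gen_grp_perm gens_sub. Qed.

Lemma rist_n_out k w : rist_n G n k -> size (val w) <= n -> k w = w.
Proof.
move=> Rk sw; elim: Rk => //.
- by move=> s [v [sv rs]]; apply: (rist_fix rs); rewrite sv.
- by move=> s t _ es _ et /=; rewrite et es.
- by move=> s s' _ e c _; rewrite -{1}e c.
Qed.

Lemma restr_inv v k : rist_n G n k -> (forall w, pre v (k w) = pre v w) ->
  restr v (invf k) = invf (restr v k).
Proof.
move=> /rist_n_sub Gk kp; apply/esym/invf_unique => w; rewrite /restr.
  by case: (boolP (pre v w)) => p; rewrite ?kp ?p ?(invfK GG) // (negbTE p).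
case: (boolP (pre v w)) => p; last by rewrite (negbTE p).
by rewrite -kp (invfKV GG) // p.
Qed.

Lemma rist_n_restr v k : size (val v) = n -> rist_n G n k ->
  (forall w, pre v (k w) = pre v w) /\ rist_v G v (restr v k).
Proof.
move=> sv; elim=> {k}.
- by split=> //; rewrite restr_id; exact: (grp_id (rist_perm v)).
- move=> s [u [su rs]].
  case: (pselect (u = v)) => [<-|ne].
    by split=> [w|]; rewrite ?(rist_pre _ rs) // restr_rist.
  have dis w : pre v w -> ~~ pre u w.
    by move=> pv; apply/negP => pu; apply/ne/(pre_eq _ pu pv); rewrite su sv.
  have fx w : pre v w -> s w = w by move/dis/(rist_out rs).
  split=> [w|].
    case: (boolP (pre v w)) => pv; first by rewrite fx.
    case: (boolP (pre u w)) => pu; last by rewrite (rist_out rs pu) (negbTE pv).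
    by apply/negbTE/negP => /dis; rewrite (rist_pre _ rs) pu.
  have -> : restr v s = id.
    by apply/funext => w; rewrite /restr; case: ifP => // /fx.
  exact: (grp_id (rist_perm v)).
- move=> s t _ [sp rs] _ [tp rt]; split; first by move=> w /=; rewrite sp tp.
  by rewrite restr_comp //; exact: (grp_mul (rist_perm v)).
- move=> s s' Rs [sp rs] c c'; split; first by move=> w; rewrite -{2}(c' w) sp.
  rewrite -(invf_unique c c') restr_inv //; exact: (grp_inv (rist_perm v)).
Qed.

(** Generators of the product project to generators of each factor. *)
Lemma rist_fin_gen v : size (val v) = n -> fin_gen_mon (rist_n G n) ->
  fin_gen_mon (rist_v G v).
Proof.
move=> sv [S [finS SR RS]]; exists (restr v @` S); split.
- exact: finite_image.
- by move=> _ [s /SR /(rist_n_restr sv) [_ rs] <-].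
move=> k rk; rewrite -(restr_rist rk).
suff [_ //] : rist_n G n k /\ mon (restr v @` S) (restr v k).
elim: (RS _ (rist_sub_n sv rk)) => [|s g Ss _ [Rg IH]].
  by rewrite restr_id; split; [exact: (grp_id rist_n_perm)|exact: mon_id].
split; first by apply: (grp_mul rist_n_perm) => //; exact: SR.
rewrite restr_comp; last by case: (rist_n_restr sv Rg).
by apply: mon_step => //; exists s.
Qed.

Lemma derived_restr v k : size (val v) = n -> derived (rist_n G n) k ->
  derived (rist_v G v) (restr v k).
Proof.
move=> sv Dk; have Rn := rist_n_perm; have Rv := rist_perm v.
have rp g : rist_n G n g -> forall w, pre v (g w) = pre v w.
  by case/(rist_n_restr sv).
have rr g : rist_n G n g -> rist_v G v (restr v g).
  by case/(rist_n_restr sv).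
have Dsub := derived_sub Rn (fun g Hg => Hg).
suff [] : rist_n G n k /\ derived (rist_v G v) (restr v k) by [].
elim: Dk => {k}.
- by rewrite restr_id; split; [exact: grp_id|exact: (grp_id (rist_derived_perm v))].
- move=> _ [a [a' [b [b' [Ra Rb [ca ca'] [cb cb'] ->]]]]].
  rewrite -(invf_unique ca ca') -(invf_unique cb cb').
  have Ra' := grp_inv Rn Ra; have Rb' := grp_inv Rn Rb.
  split; first exact: grp_comm.
  do 3 (rewrite restr_comp; last exact: rp).
  rewrite !restr_inv //; try exact: rp.
  by apply: (derived_comm Rv) => //; exact: rr.
- move=> s t _ [Rs Ds] _ [Rt Dt]; split; first exact: (grp_mul Rn).
  by rewrite restr_comp; [exact: (grp_mul (rist_derived_perm v))|exact: rp].
- move=> s s' _ [Rs Ds] c c'; rewrite -(invf_unique c c'); split; first exact: (grp_inv Rn).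
  by rewrite restr_inv //; [exact: (grp_inv (rist_derived_perm v))|exact: rp].
Qed.

(* An element of [rist_n G n] is the product of its restrictions to the subtrees
   hanging at level [n]. *)
Lemma rist_n_ind (P : set (V -> V)) k : rist_n G n k -> P id ->
  (forall v g, size (val v) = n -> G g -> P g -> P (restr v k \o g)) -> P k.
Proof.
move=> Rk Pid Pstep; have [l ul Hl] := level_list n.
(* [F s] is the product of the components of [k] at the vertices of [s]; for the whole level it is
   [k]. *)
pose F s w := if has (pre^~ w) s then k w else w.
have -> : k = F l.
  apply/funext => w; rewrite /F; case: ifP => // /negbT /hasPn Hno; apply: (rist_n_out Rk).
  rewrite leqNgt; apply/negP => lt.
  have := Hno (trunc n w); rewrite Hl size_trunc ?eqxx ?(ltnW lt) //.
  by rewrite pre_trunc => /(_ isT).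
have {Hl} : {subset l <= [pred u : V | size (val u) == n]} by move=> u; rewrite Hl.
suff H s : uniq s -> {subset s <= [pred u : V | size (val u) == n]} -> G (F s) /\ P (F s).
  by move=> sl; case: (H l).
elim: s => [|v s IH] /=; first by split=> //; exact: grp_id.
move=> /andP[vs us] sub; have sv : size (val v) = n by apply/eqP/sub; rewrite inE eqxx.
have sub' : {subset s <= [pred u : V | size (val u) == n]}.
  by move=> u us'; apply: sub; rewrite inE us' orbT.
have [GF PF] := IH us sub'; have [kp rk] := rist_n_restr sv Rk.
have -> : F (v :: s) = restr v k \o F s.
  apply/funext => w; rewrite /F /restr /=.
  case: (boolP (has _ s)) => [/hasP[u us' pu]|_] /=; last by rewrite orbF.
  rewrite orbT kp; case: (boolP (pre v w)) => // pv.
  move: vs; rewrite (pre_eq _ pv pu) ?us' //.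
  by rewrite sv; apply/esym/eqP; exact: sub'.
by split; [apply: grp_mul => //; exact: rist_sub rk|apply: Pstep].
Qed.

End Level.

(** * Finite index subgroups of rigid stabilizers move rays *)

Section Rays.
Variable (x : bnd deg).
Hypothesis trans : forall u w : V, size (val u) = size (val w) -> exists2 g, G g & g u = w.
Hypothesis x_nontriv : forall m, exists2 g, rist_v G (bpref x m) g & exists z, g z <> z.

Lemma ray_fix m g : G g -> g (bpref x m) = bpref x m ->
  forall i, i <= m -> g (bpref x i) = bpref x i.
Proof.
move=> Gg e i le; rewrite -(trunc_bpref x le) aut_trunc ?e //; exact: Gaut.
Qed.

(** A nontrivial element of the rigid stabilizer of the [m]-th vertex moves some [z] below it. If
    [z] is on the ray, this element serves; otherwise level transitivity carries the ray to pass
    through [z], which keeps its [m]-th vertex. *)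
Lemma ray_moved m : exists2 g, G g & g (bpref x m) = bpref x m /\
  exists2 j, m <= j & g (bpref x j) <> bpref x j.
Proof.
have [g rg [z gz]] := x_nontriv m.
have pz : pre (bpref x m) z by apply: contrapT => /negP /(rist_out rg).
have le := pre_size pz; rewrite size_bpref in le.
set j := size (val z) in le *.
case: (pselect (z = bpref x j)) => [e|ne].
  exists g; first exact: rist_sub rg.
  split; first by apply: (rist_fix rg); rewrite leqnn.
  by exists j => //; rewrite -e.
have [h Gh hz] := trans (size_bpref x j).
exists h => //; split; last by exists j => //; rewrite hz.
rewrite -(trunc_bpref x le) aut_trunc ?hz; last exact: Gaut.
by move/preP: pz; rewrite size_bpref trunc_bpref.
Qed.

(** If [K] fixed the ray, every element of [G] would act on it beyond level [n] as one of finitely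
    many products of coset representatives. Those that move the ray there do so before a common
    level, contradicting [ray_moved]. *)
Lemma fin_index_moves_ray n (K : set (V -> V)) : fin_index G (rist_n G n) ->
  is_perm_group K -> K `<=` rist_v G (bpref x n) ->
  fin_index (rist_v G (bpref x n)) K ->
  exists2 a, K a & exists m, a (bpref x m) <> bpref x m.
Proof.
move=> iG KK Ksub iK; apply: contrapT => Hno.
have Kfix a m : K a -> a (bpref x m) = bpref x m.
  by move=> Ka; apply: contrapT => ne; apply: Hno; exists a => //; exists m.
have sv := size_bpref x n.
have [l1 [l1G Hl1]] := fin_index_reps GG (rist_n_perm n) (@rist_n_sub n) iG.
have [l2 [l2G Hl2]] := fin_index_reps (rist_perm _) KK Ksub iK.
pose O := [seq r1 \o r2 | r1 <- l1, r2 <- l2].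
have OP g : G g -> exists2 o, o \in O & forall j, n <= j -> g (bpref x j) = o (bpref x j).
  move=> Gg; have [r1 r1l Rk] := Hl1 _ Gg; have Gr1 := l1G _ r1l.
  set k := invf r1 \o g in Rk; have [_ rk] := rist_n_restr sv Rk.
  have [r2 r2l Kk] := Hl2 _ rk; exists (r1 \o r2).
    by apply/allpairsP; exists (r1, r2).
  move=> j le /=; have := Kfix _ j Kk.
  rewrite /= /restr (pre_bpref x le) => e.
  rewrite -{2}e (invfKV (rist_perm (bpref x n))) ?(invfKV GG) //; exact: l2G.
have [M HM] : exists M, n <= M /\ forall o, o \in O ->
    (exists2 j, n <= j & o (bpref x j) <> bpref x j) ->
    exists j, [/\ n <= j, j <= M & o (bpref x j) <> bpref x j].
  elim: O {OP} => [|o O [M [nM HM]]]; first by exists n.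
  case: (pselect (exists2 j, n <= j & o (bpref x j) <> bpref x j)) => [[j nj ne]|no].
    exists (maxn j M); split; first by rewrite (leq_trans nj) // leq_maxl.
    move=> o'; rewrite inE => /orP[/eqP -> _|/HM H /H [i [ni iM ne']]].
      by exists j; rewrite leq_maxl.
    by exists i; rewrite (leq_trans iM) ?leq_maxr.
  exists M; split=> // o'; rewrite inE => /orP[/eqP -> //|]; exact: HM.
have [nM {}HM] := HM.
have [g Gg [gM [j Mj ne]]] := ray_moved M.
have [o oO Ho] := OP _ Gg.
have [|i [ni iM]] := HM _ oO.
  by exists j; rewrite -?Ho // (leq_trans nM).
by rewrite -Ho // (ray_fix Gg gM).
Qed.

End Rays.

End RigidStabilizers.

End Trees.

(** * Commuting groups of tame homeomorphisms *)

Lemma near_seq (X : topologicalType) (I : eqType) (x : X) (P : I -> X -> Prop) (l : seq I) :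
  (forall i, i \in l -> \forall y \near x, P i y) ->
  \forall y \near x, forall i, i \in l -> P i y.
Proof.
elim: l => [|i l IH] HP; first by apply: nearW.
have Hi := HP i (mem_head _ _).
have Hl : \forall y \near x, forall j, j \in l -> P j y.
  by apply: IH => j jl; apply: HP; rewrite inE jl orbT.
apply: filterS2 Hi Hl => y Pi Pl j; rewrite inE => /orP[/eqP->//|]; exact: Pl.
Qed.

Record action (X : Type) (A : choiceType) (G : set (A -> A))
  (rho : (A -> A) -> (X -> X)) : Prop := Action {
  action_id : rho id = id;
  actionM : forall g h, G g -> G h -> rho (g \o h) = rho g \o rho h }.

Section Actions.
Variables (X : topologicalType) (A : choiceType) (G : set (A -> A)).
Variable rho : (A -> A) -> (X -> X).
Hypothesis GG : is_perm_group G.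
Hypothesis rhoA : action G rho.
Let rho_id := action_id rhoA.
Let rhoM := actionM rhoA.

Lemma rhoK g : G g -> cancel (rho g) (rho (invf g)).
Proof.
move=> Gg x; have := rhoM (grp_inv GG Gg) Gg.
by rewrite (invf_comp_id GG Gg) rho_id => /(congr1 (@^~ x)).
Qed.

Lemma rhoKV g : G g -> cancel (rho (invf g)) (rho g).
Proof.
by move=> Gg; rewrite -{2}(invfV GG Gg); apply: rhoK; exact: grp_inv.
Qed.

Definition commuting (K L : set (A -> A)) :=
  forall k l, K k -> L l -> k \o l = l \o k.

Lemma rho_commute g h y : G g -> G h -> g \o h = h \o g ->
  rho g (rho h y) = rho h (rho g y).
Proof.
by move=> Gg Gh e; rewrite -[LHS]/((rho g \o rho h) y) -rhoM // e rhoM.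
Qed.

Definition orb (K : set (A -> A)) x : set X := [set rho k x | k in K].

Definition germ1 (x : X) : set (A -> A) := [set k | G k /\ \forall y \near x, rho k y = y].

Definition fixer y : set (A -> A) := [set k | G k /\ rho k y = y].

Lemma perm_groupI (K L : set (A -> A)) :
  is_perm_group K -> is_perm_group L -> is_perm_group (K `&` L).
Proof.
move=> KK LL; split.
- by split; exact: grp_id.
- by move=> g h [? ?] [? ?]; split; exact: grp_mul.
- move=> g [Kg Lg]; exists (invf g); last by split; [exact: invfK Kg|exact: invfKV Kg].
  by split; exact: grp_inv.
Qed.

Lemma fixer_perm y : is_perm_group (fixer y).
Proof.
split.
- by split; [exact: grp_id|rewrite rho_id].
- move=> g h [Gg eg] [Gh eh]; split; first exact: grp_mul.
  by rewrite rhoM //= eh eg.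
- move=> g [Gg eg]; exists (invf g); last by split; [exact: (invfK GG)|exact: (invfKV GG)].
  by split; [exact: grp_inv|rewrite -{1}eg rhoK].
Qed.

Lemma germ1_perm x : is_perm_group (germ1 x).
Proof.
split.
- by split; [exact: grp_id|rewrite rho_id; apply: nearW].
- move=> g h [Gg eg] [Gh eh]; split; first exact: grp_mul.
  by apply: filterS2 eg eh => y eg eh; rewrite rhoM //= eh eg.
- move=> g [Gg eg]; exists (invf g); last by split; [exact: (invfK GG)|exact: (invfKV GG)].
  split; first exact: grp_inv.
  by apply: filterS eg => y eg; rewrite -{1}eg rhoK.
Qed.

Definition meets (K L : set (A -> A)) x : set (A -> A) :=
  [set a | K a /\ exists2 b, L b & rho a x = rho b x].

(** If [a x = b x] and [a' x = b' x], commutation gives [a a' x = a b' x = b' a x = b' b x]; note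
    the reversed order in [L]. *)
Lemma meets_perm K L x : is_perm_group K -> is_perm_group L -> K `<=` G -> L `<=` G ->
  commuting K L -> is_perm_group (meets K L x).
Proof.
move=> KK LL KG LG com; split.
- by split; [exact: grp_id|exists id => //; exact: grp_id].
- move=> a a' [Ka [b Lb e]] [Ka' [b' Lb' e']]; split; first exact: grp_mul.
  exists (b' \o b); first exact: grp_mul.
  rewrite (rhoM (KG _ Ka) (KG _ Ka')) (rhoM (LG _ Lb') (LG _ Lb)).
  by rewrite /= e' (rho_commute _ (KG _ Ka) (LG _ Lb') (com _ _ Ka Lb')) e.
- move=> a [Ka [b Lb e]]; exists (invf a); last by split; [exact: (invfK KK)|exact: (invfKV KK)].
  have Ka' := grp_inv KK Ka; have Lb' := grp_inv LL Lb.
  split=> //; exists (invf b) => //.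
  apply: (can_inj (rhoK (LG _ Lb))).
  rewrite (rhoKV (LG _ Lb)) -(rho_commute _ (KG _ Ka') (LG _ Lb) (com _ _ Ka' Lb)).
  by rewrite -e rhoK //; exact: KG.
Qed.

(** Finite generation makes the neighbourhood uniform: a point fixed by all generators is fixed by
    all words. *)
Lemma near_fixed (x : X) K : K `<=` germ1 x -> fin_gen_mon K ->
  \forall y \near x, forall k, K k -> rho k y = y.
Proof.
move=> KG [S [finS SK KS]]; have [l Hl] := finite_set_seq finS.
have := @near_seq _ _ x (fun s y => rho s y = y) l.
have /[swap]/[apply] : forall s, s \in l -> \forall y \near x, rho s y = y.
  by move=> s /Hl /SK /KG [].
apply: filterS => y Hy k Kk.
suff [//] : rho k y = y /\ G k.
elim: (KS _ Kk) => [|s g Ss _ [e Gg]]; first by rewrite rho_id; split=> //; exact: grp_id.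
have [Gs _] := KG _ (SK _ Ss).
by rewrite rhoM //= e Hy; [split=> //; exact: grp_mul|exact/Hl].
Qed.

Lemma orb_equiv K x y z : is_perm_group K -> K `<=` G ->
  orb K x y -> orb K x z -> orb K y z.
Proof.
move=> KK KG [k Kk <-] [l Kl <-]; have Kk' := grp_inv KK Kk.
exists (l \o invf k); first exact: grp_mul.
by rewrite rhoM /= ?rhoK //; exact: KG.
Qed.

Lemma orb_self K x : is_perm_group K -> orb K x x.
Proof. by move=> KK; exists id; [exact: grp_id|rewrite rho_id]. Qed.

End Actions.

(* The facts about actions of groups of strongly bounded type on which the
   dynamical part of the proof rests; [cof] is the relation of being cofinal. *)
Record tame_action (X : topologicalType) (A : choiceType) (G : set (A -> A))
  (rho : (A -> A) -> (X -> X)) (cof : X -> X -> Prop) : Prop := TameAction {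
  tame_action_action : action G rho;
  tame_cont : forall g, G g -> continuous (rho g);
  cof_refl : forall x, cof x x;
  cof_trans : forall x y z, cof x y -> cof y z -> cof x z;
  cof_regular : forall g, G g ->
    exists2 E, finite_set E & forall x, ~ E x -> cof x (rho g x);
  fix_regular : forall g, G g ->
    exists2 E, finite_set E & forall x, ~ E x -> rho g x = x -> germ1 G rho x g;
  cof_orbits : forall K, is_perm_group K -> K `<=` G -> fin_gen_mon K ->
    exists C, forall x (s : seq X), uniq s ->
      (forall y, y \in s -> cof x y /\ infinite_set (orb rho K y)) ->
      (forall y z, y \in s -> z \in s -> orb rho K y z -> y = z) -> size s <= C;
  isotropy : forall x K, is_perm_group K -> K `<=` fixer G rho x -> fin_gen_mon K ->
    fin_index K (K `&` germ1 G rho x) }.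

Section TameActions.
Variables (X : topologicalType) (A : choiceType) (G : set (A -> A)).
Variables (rho : (A -> A) -> (X -> X)) (cof : X -> X -> Prop).
Hypothesis GG : is_perm_group G.
Hypothesis rhoT : tame_action G rho cof.
Let rhoA := tame_action_action rhoT.
Let rho_id := action_id rhoA.
Let rhoM := actionM rhoA.

(** The stabilizer of [x] in [K] has finite index, so it is finitely generated and finiteness of
    isotropy applies: a finite index subgroup has trivial germs at [x]. Being finitely generated
    again, it fixes a whole neighbourhood; the core makes it normal. *)
Lemma finite_orbit_fixed (x : X) K : is_perm_group K -> K `<=` G -> fin_gen_mon K ->
  finite_set (orb rho K x) -> exists K2, [/\ is_perm_group K2, K2 `<=` K,
    forall z k, K z -> K2 k -> K2 (invf z \o k \o z), fin_index K K2 &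
    \forall y \near x, forall k, K2 k -> rho k y = y].
Proof.
move=> KK KG fgK fin.
pose K1 := K `&` fixer G rho x.
have K1p : is_perm_group K1 := perm_groupI KK (fixer_perm GG rhoA x).
have iK1 : fin_index K K1.
  exists X, (fun k => rho k x); split=> // g h Kg Kh e; split.
    by apply: grp_mul => //; exact: grp_inv.
  have [Gg Gh] := (KG _ Kg, KG _ Kh); have Gg' := grp_inv GG Gg.
  by split; [exact: grp_mul|rewrite rhoM //= -e (rhoK GG rhoA)].
have fg1 : fin_gen_mon K1 by apply: (schreier_fin_gen KK) => // k [].
have i2 := isotropy rhoT K1p (@subIsetr _ _ _) fg1.
set K' := K1 `&` germ1 G rho x in i2.
have K'p : is_perm_group K' := perm_groupI K1p (germ1_perm GG rhoA x).
have K'K : K' `<=` K by move=> k [[]].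
have iK' : fin_index K K' by apply: (fin_index_trans KK K1p) => // k [].
have fg' : fin_gen_mon K' by apply: (schreier_fin_gen KK).
exists (core K K'); split.
- exact: core_perm.
- by move=> k [].
- by move=> z k; exact: core_normal.
- exact: fin_index_core.
- have := near_fixed GG rhoA (@subIsetr _ _ _) fg'.
  by apply: filterS => y Hy k /(core_sub KK); exact: Hy.
Qed.

(** Along a word, cofinality is kept except where a generator is applied to one of its finitely many
    exceptional points; there the image becomes the new reference point. *)
Lemma orbit_cof (x : X) K : K `<=` G -> fin_gen_mon K ->
  exists cs : seq X, forall k, K k -> exists2 c, c \in cs & cof c (rho k x).
Proof.
move=> KG [S [finS SK KS]]; have [l Hl] := finite_set_seq finS.
have crefl := cof_refl rhoT.
have [E [finE HE]] : exists E, finite_set E /\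
    forall s, s \in l -> forall x, ~ E x -> cof x (rho s x).
  have : forall s, s \in l -> G s by move=> s /Hl /SK /KG.
  elim: (l) => [|s l' IH] Gl; first by exists set0.
  have [|E [finE HE]] := IH; first by move=> t tl; apply: Gl; rewrite inE tl orbT.
  have [E' finE' HE'] := cof_regular rhoT (Gl s (mem_head _ _)).
  exists (E `|` E'); split; first by rewrite finite_setU.
  move=> t; rewrite inE => /orP[/eqP -> y nE|/HE Ht y nE].
    by apply: HE' => Ey; apply: nE; right.
  by apply: Ht => Ey; apply: nE; left.
have [le Hle] := finite_set_seq finE.
exists (x :: [seq rho s y | s <- l, y <- le]) => k Kk.
suff [//] : (exists2 c, c \in x :: [seq rho s y | s <- l, y <- le] & cof c (rho k x)) /\ G k.
elim: (KS _ Kk) => [|s g Ss _ [[c cl cg] Gg]].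
  by split; [exists x; rewrite ?mem_head ?rho_id|exact: grp_id].
have Gs := KG _ (SK _ Ss); split; last exact: grp_mul.
rewrite rhoM //=; case: (pselect (E (rho g x))) => [Eg|nE].
  exists (rho s (rho g x)) => //; rewrite inE; apply/orP; right.
  by apply/allpairsP; exists (s, rho g x); split=> //; [exact/Hl|exact/Hle].
by exists c => //; apply: (cof_trans rhoT cg _); apply: HE => //; exact/Hl.
Qed.

(** Since [K] commutes with [L], all points of the orbit [Kx] have infinite [L]-orbits. They are
    cofinal to finitely many points, each allowing boundedly many such orbits, so [Kx] meets
    finitely many [L]-orbits. The orbit containing [a x] then separates cosets. *)
Lemma fin_index_meets (x : X) K L : is_perm_group K -> is_perm_group L -> K `<=` G -> L `<=` G ->
  commuting K L -> fin_gen_mon K -> fin_gen_mon L -> infinite_set (orb rho L x) ->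
  fin_index K (meets rho K L x).
Proof.
move=> KK LL KG LG com fgK fgL inf.
have infK a : K a -> infinite_set (orb rho L (rho a x)).
  move=> Ka; apply: contra_not inf => fin; have Ga := KG _ Ka.
  apply: sub_finite_set (finite_image (rho (invf a)) fin) => _ [b Lb <-].
  exists (rho b (rho a x)); first by exists b.
  by rewrite -(rho_commute rhoA _ Ga (LG _ Lb) (com _ _ Ka Lb)) (rhoK GG rhoA).
have [C HC] := cof_orbits rhoT LL LG fgL.
have [cs Hcs] := orbit_cof x KG fgK.
have reps c : exists R : seq X, forall z, orb rho K x z -> cof c z ->
    exists2 r, r \in R & orb rho L r z.
  (* A longest list of points of [Kx] cofinal to [c] in distinct [L]-orbits represents all these
     orbits; its length is bounded by [C]. *)
  pose Q (s : seq X) := [/\ uniq s, forall y, y \in s -> orb rho K x y /\ cof c y &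
    forall y z, y \in s -> z \in s -> orb rho L y z -> y = z].
  have Qbound s : Q s -> size s <= C.
    case=> us s1 s2; apply: (HC c) => // y ys; have [[a Ka <-] cy] := s1 _ ys.
    by split=> //; exact: infK.
  have ex0 : exists n, `[< exists2 s, Q s & size s = n >].
    by exists 0; apply/asboolP; exists [::].
  have bnd n : `[< exists2 s, Q s & size s = n >] -> n <= C.
    by move=> /asboolP [s /Qbound le <-].
  have [m /asboolP [s [us s1 s2] sm] smax] := ex_maxnP ex0 bnd.
  exists s => z oz cz; apply: contrapT => Hno.
  have zs : z \notin s.
    by apply/negP => zs; apply: Hno; exists z => //; exact: (orb_self rhoA).
  suff : m.+1 <= m by rewrite ltnn.
  apply: smax; apply/asboolP; exists (z :: s); last by rewrite /= sm.
  split; first by rewrite /= zs us.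
    by move=> y; rewrite inE => /orP[/eqP ->|/s1].
  move=> y y'; rewrite !inE => /orP[/eqP ->|ys] /orP[/eqP ->|ys'] // o.
  - exfalso; apply: Hno; exists y' => //; exact: (orb_equiv GG rhoA LL LG o (orb_self rhoA _ LL)).
  - by exfalso; apply: Hno; exists y.
  - exact: s2.
have [Rs HRs] := choice reps.
pose R := flatten [seq Rs c | c <- cs].
have RP a : K a -> exists2 r, r \in R & orb rho L r (rho a x).
  move=> Ka; have [c cl cc] := Hcs _ Ka.
  have [|r rc or] := HRs c (rho a x) _ cc; first by exists a.
  by exists r => //; apply/flattenP; exists (Rs c) => //; exact: map_f.
pose f a := xget x [set r | r \in R /\ orb rho L r (rho a x)].
have fP a : K a -> f a \in R /\ orb rho L (f a) (rho a x).
  move=> /RP [r rR or].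
  by apply: (@xgetPex _ x [set r | r \in R /\ orb rho L r (rho a x)]); exists r.
exists X, f; split.
  by apply: sub_finite_set (finite_seq R) => _ [a /fP [? _] <-].
move=> a a' Ka Ka' e; have [_ oa] := fP _ Ka; have [_ oa'] := fP _ Ka'.
have Kai := grp_inv KK Ka.
rewrite -e in oa'; split; first exact: grp_mul.
have [b Lb eb] := orb_equiv GG rhoA LL LG oa oa'; exists b => //.
have [Gai Gb] := (KG _ Kai, LG _ Lb).
rewrite rhoM //=; last exact: KG.
rewrite -eb (rho_commute rhoA _ Gai Gb (com _ _ Kai Lb)) (rhoK GG rhoA) //; exact: KG.
Qed.

(** The element [h] fixes the whole infinite orbit [Lx], hence a point [d x] outside its exceptional
    set. Its germ there is trivial, and [d] transports this back to [x]. *)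
Lemma commuting_germ (x : X) h L : is_perm_group L -> L `<=` G -> G h -> rho h x = x ->
  (forall d, L d -> h \o d = d \o h) -> infinite_set (orb rho L x) -> germ1 G rho x h.
Proof.
move=> LL LG Gh hx com inf; have [E finE HE] := fix_regular rhoT Gh.
have [d Ld nE] : exists2 d, L d & ~ E (rho d x).
  apply: contrapT => Hno; apply: inf; apply: sub_finite_set finE => _ [d Ld <-].
  by apply: contrapT => nE; apply: Hno; exists d.
have Gd := LG _ Ld.
have cd y : rho h (rho d y) = rho d (rho h y) by apply: (rho_commute rhoA) => //; exact: com.
have [] := HE _ nE; first by rewrite cd hx.
move=> _ near_d; split=> //.
have near_x : \forall y \near x, rho h (rho d y) = rho d y by exact: (tame_cont rhoT Gd near_d).
by apply: filterS near_x => y /=; rewrite cd => /(can_inj (rhoK GG rhoA Gd)).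
Qed.

(* Once the generators of [K] agree near [x] with elements of [L], all of [K]
   does so on one neighbourhood: [s (a y) = s (b y) = b (s y) = b (t y)]. *)
Lemma meets_near (x : X) K L : is_perm_group L -> K `<=` G -> L `<=` G ->
  commuting K L -> fin_gen_mon K ->
  (forall a, K a -> exists2 b, L b & \forall y \near x, rho a y = rho b y) ->
  \forall y \near x, forall a, K a -> exists2 b, L b & rho a y = rho b y.
Proof.
move=> LL KG LG com [S [finS SK KS]] loc; have [l Hl] := finite_set_seq finS.
have : \forall y \near x, forall s, s \in l -> exists2 b, L b & rho s y = rho b y.
  apply: (near_seq (P := fun s y => exists2 b, L b & rho s y = rho b y)) => s /Hl /SK Ks.
  by have [b Lb] := loc _ Ks; apply: filterS => y e; exists b.
apply: filterS => y Hy a Ka.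
suff [//] : (exists2 b, L b & rho a y = rho b y) /\ G a.
elim: (KS _ Ka) => [|s g Ss _ [[b Lb e] Gg]].
  by split; [exists id => //|]; exact: grp_id.
have Ks := SK _ Ss; have [Gs Gb] := (KG _ Ks, LG _ Lb).
have [t Lt et] : exists2 b, L b & rho s y = rho b y by apply: Hy; exact/Hl.
split; last exact: grp_mul.
exists (b \o t); first exact: grp_mul.
rewrite (rhoM Gs Gg) (rhoM Gb (LG _ Lt)).
by rewrite /= e (rho_commute rhoA _ Gs Gb (com _ _ Ks Lb)) et.
Qed.

Lemma three_commuting (x : X) K L M : is_perm_group K -> is_perm_group L -> is_perm_group M ->
  K `<=` G -> L `<=` G -> M `<=` G ->
  commuting K L -> commuting K M -> commuting L M ->
  fin_gen_mon K -> fin_gen_mon L -> fin_gen_mon M ->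
  infinite_set (orb rho L x) -> infinite_set (orb rho M x) ->
  exists K1, [/\ is_perm_group K1, K1 `<=` K,
    forall z k, K z -> K1 k -> K1 (invf z \o k \o z), fin_index K K1 &
    \forall y \near x, forall k, derived K1 k -> rho k y = y].
Proof.
move=> KK LL MM KG LG MG cKL cKM cLM fK fL fM infL infM.
pose K0 := meets rho K L x `&` meets rho K M x.
have K0p : is_perm_group K0 by apply: perm_groupI; apply: (meets_perm GG rhoA).
have K0K : K0 `<=` K by move=> k [[]].
have iK0 : fin_index K K0 by apply: fin_indexI; apply: fin_index_meets.
pose K1 := core K K0.
have K1p : is_perm_group K1 by exact: core_perm.
have K1K : K1 `<=` K by move=> k [].
have iK1 : fin_index K K1 by exact: fin_index_core.
have fK1 : fin_gen_mon K1 by exact: (schreier_fin_gen KK).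
have K1G : K1 `<=` G by move=> k /K1K /KG.
(* If [a x = b x], then [b^-1 a] fixes [x] and commutes with [Q], whose orbit at [x] is infinite, so
   its germ is trivial. This is used with [L] and [M] in both roles. *)
have loc (P Q : set (A -> A)) : is_perm_group P -> is_perm_group Q -> P `<=` G -> Q `<=` G ->
    commuting K P -> commuting K Q -> commuting P Q -> infinite_set (orb rho Q x) ->
    K1 `<=` meets rho K P x ->
    forall a, K1 a -> exists2 b, P b & \forall y \near x, rho a y = rho b y.
  move=> PP QQ PG QG cKP cKQ cPQ infQ sub a K1a.
  have [Ka [b Pb e]] := sub _ K1a; exists b => //.
  have [Ga Gb] := (KG _ Ka, PG _ Pb); have Gb' := grp_inv GG Gb.
  have Pb' := grp_inv PP Pb.
  have [] : germ1 G rho x (invf b \o a).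
    apply: (commuting_germ QQ) => //; first exact: grp_mul.
      by rewrite rhoM //= e (rhoK GG rhoA).
    move=> d Qd; rewrite -[LHS]/(invf b \o (a \o d)) (cKQ _ _ Ka Qd).
    by rewrite -[LHS]/((invf b \o d) \o a) (cPQ _ _ Pb' Qd).
  move=> _; apply: filterS => y; rewrite rhoM //= => ey.
  by rewrite -[in RHS]ey (rhoKV GG rhoA).
have cML : commuting M L by move=> m l Mm Ll; rewrite (cLM _ _ Ll Mm).
have subL : K1 `<=` meets rho K L x by move=> k /(core_sub KK) [].
have subM : K1 `<=` meets rho K M x by move=> k /(core_sub KK) [].
have cK1 (P : set (A -> A)) : commuting K P -> commuting K1 P.
  by move=> cP k p /K1K Kk Pp; exact: cP.
have nL := meets_near LL K1G LG (cK1 _ cKL) fK1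
  (loc L M LL MM LG MG cKL cKM cLM infM subL).
have nM := meets_near MM K1G MG (cK1 _ cKM) fK1
  (loc M L MM LL MG LG cKM cKL cML infL subM).
exists K1; split=> //; first by move=> z k; exact: core_normal.
apply: filterS2 nL nM => y HL HM k Dk.
suff [//] : fixer G rho y k.
move: Dk; apply: (derived_min GG K1G (fixer_perm GG rhoA y)) => a b K1a K1b.
have [Ga Gb] := (K1G _ K1a, K1G _ K1b).
have [Ga' Gb'] := (grp_inv GG Ga, grp_inv GG Gb).
split; first exact: grp_comm.
have [l Ll el] := HL _ K1a; have [m Mm em] := HM _ K1b.
have [Gl Gm] := (LG _ Ll, MG _ Mm).
(* With [a y = l y] and [b y = m y]: [a b y = a m y = m a y = m l y = l m y = l b y = b l y = b a
   y]. *)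
have ab : rho a (rho b y) = rho b (rho a y).
  rewrite em (rho_commute rhoA _ Ga Gm (cKM _ _ (K1K _ K1a) Mm)) el.
  rewrite -(rho_commute rhoA _ Gl Gm (cLM _ _ Ll Mm)) -em.
  by rewrite (rho_commute rhoA _ Gb Gl (cKL _ _ (K1K _ K1b) Ll)).
have Gab' := grp_mul GG Ga' Gb'.
rewrite (rhoM (grp_mul GG Gab' Ga) Gb) (rhoM Gab' Ga) (rhoM Ga' Gb').
by rewrite /= ab (rhoK GG rhoA) // (rhoK GG rhoA).
Qed.

End TameActions.

(** * Groups of bounded type *)

Section BratteliActions.
Variables (X : topologicalType) (A : choiceType) (G : set (A -> A)).
Variables (H : (X -> X) -> Prop) (rho : (A -> A) -> (X -> X)).
Hypothesis GG : is_perm_group G.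
Hypothesis rhoA : action G rho.
Let rho_id := action_id rhoA.
Let rhoM := actionM rhoA.
Hypothesis rhoH : forall g, G g -> H (rho g).

Variables (bV bE : nat -> nat) (bo bt : nat -> nat -> nat).
Variables (phi : X -> (nat -> nat)) (psi : (nat -> nat) -> X).
Notation path := (bpath bE bo bt).
Notation cnj h := (fun y : nat -> nat => phi (h (psi y))).
Hypothesis Bdiag : is_bratteli bV bE bo bt.
Hypothesis phi_path : forall x, path (phi x).
Hypothesis psiK : forall x, psi (phi x) = x.
Hypothesis phi_near : forall x n, \forall x' \near x, agree n (phi x') (phi x).
Hypothesis Hbounded : forall h, H h -> bounded_type bV bE bo bt (cnj h).
Hypothesis Hisotropy : forall x, path x ->
  forall S : list (X -> X), (forall s, List.In s S -> H s /\ cnj s x =1 x) ->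
  exists R : list (X -> X), forall w, gen_grp (fun s => List.In s S) w ->
    exists r, List.In r R /\ exists k, (H k /\ exists m, forall y, path y ->
      agree m y x -> cnj k y =1 y) /\ w = r \o k.

(** Letter [i] is the edge into level [i+1], so such paths share all edges beyond level [n]; for
    positive [n] their prefixes of length [n] end at the same vertex. *)
Definition tail_eq n (x y : X) := forall i, n <= i -> phi x i = phi y i.
Definition cofinal x y := exists n, tail_eq n x y.

Lemma phi_inj x y : phi x =1 phi y -> x = y.
Proof. by move=> /funext e; rewrite -(psiK x) e psiK. Qed.

Lemma tail_eq_mono m n x y : m <= n -> tail_eq m x y -> tail_eq n x y.
Proof. by move=> mn e i ni; apply: e; exact: leq_trans ni. Qed.

Lemma cofinal_refl x : cofinal x x. Proof. by exists 0. Qed.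

Lemma cofinal_trans x y z : cofinal x y -> cofinal y z -> cofinal x z.
Proof.
move=> [m e] [n e']; exists (maxn m n) => i; rewrite geq_max => /andP[mi ni].
by rewrite e // e'.
Qed.

Lemma nonsingular_outside g : G g -> exists2 E : set X, finite_set E &
  forall x, ~ E x -> ~ singular bE bo bt (cnj (rho g)) (phi x).
Proof.
move=> /rhoH /Hbounded [[l Hl] _]; exists (psi @` [set y | List.In y l]).
  by apply: finite_image; exact: finite_set_In.
by move=> x nE sx; apply: nE; exists (phi x); [apply: Hl|exact: psiK].
Qed.

Lemma nonsingularP g x : ~ singular bE bo bt (cnj (rho g)) (phi x) ->
  exists n (c : nat -> nat), forall y, agree n (phi y) (phi x) ->
    forall i, phi (rho g y) i = if i < n then c i else phi y i.
Proof.
move=> /contrapT [s [e [fs Le [_ cs] [m Hm]]]].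
(* The length covers both the replaced prefix and the neighbourhood of validity; between the two,
   the letters are those of [x]. *)
exists (maxn (size s) m), (fun i => if i < size s then nth 0 e i else phi x i).
move=> y yx i.
have ys : agree (size s) (phi y) (nth 0 s).
  by move=> j lt; rewrite -cs // yx // leq_max lt.
have ym : agree m (phi y) (phi x).
  by move=> j lt; rewrite yx // leq_max lt orbT.
have := Hm (phi y) (conj (phi_path y) ys) ym i.
rewrite /= psiK => ->; rewrite /prefrep leq_max.
case: ifP => //= _; case: ifP => // lt; apply: yx; by rewrite leq_max lt orbT.
Qed.

Lemma cofinal_regular g : G g ->
  exists2 E, finite_set E & forall x, ~ E x -> cofinal x (rho g x).
Proof.
move=> /nonsingular_outside [E finE HE]; exists E => // x /HE /nonsingularP.
case=> n [c Hc]; exists n => i ni; rewrite Hc //.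
by rewrite ltnNge ni.
Qed.

(** A prefix rewriting that fixes [x] writes the prefix of [x] itself, so it is the identity near
    [x]. *)
Lemma fixed_regular g : G g ->
  exists2 E, finite_set E & forall x, ~ E x -> rho g x = x -> germ1 G rho x g.
Proof.
move=> Gg; have [E finE HE] := nonsingular_outside Gg; exists E => // x /HE.
move=> /nonsingularP [n [c Hc]] gx; split=> //.
have := phi_near x n; apply: filterS => y yx.
apply: phi_inj => i; rewrite Hc //.
case: ifP => // lt; rewrite yx //.
have := Hc x (fun _ _ => erefl) i; by rewrite gx lt.
Qed.

Lemma finite_tail_eq n x : finite_set [set y | tail_eq n x y].
Proof.
have [l Hl] : exists l : seq (seq nat), forall y, mkseq (phi y) n \in l.
  suff [l Hl] : exists l : seq (seq nat), forall z, (forall i, z i < bE i.+1) ->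
      mkseq z n \in l.
    by exists l => y; apply: Hl => i; case: (phi_path y i).
  elim: n => [|n [l Hl]]; first by exists [:: [::]].
  exists [seq rcons s e | s <- l, e <- iota 0 (bE n.+1)] => z zb.
  apply/allpairsP; exists (mkseq z n, z n); rewrite mkseqS; split=> //=.
    exact: Hl.
  by rewrite mem_iota add0n /=.
apply: (@sub_finite_set _ _
  ((fun s => psi (fun i => if i < n then nth 0 s i else phi x i)) @` [set` l])).
  move=> y xy; exists (mkseq (phi y) n); first exact: Hl.
  rewrite -[RHS]psiK; congr psi; apply/funext => i.
  by case: ltnP => lt; [rewrite nth_mkseq|exact: xy].
by apply: finite_image; exact: finite_seq.
Qed.

Lemma prefix_fpath n y : 0 < n -> Defs.fpath bE bo bt (mkseq (phi y) n).
Proof.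
move=> n0; split; rewrite size_mkseq // => i lt.
  by rewrite nth_mkseq //; case: (phi_path y i).
by rewrite !nth_mkseq ?(ltnW lt) //; case: (phi_path y i).
Qed.

Lemma prefix_cyl n y : cyl bE bo bt (mkseq (phi y) n) (phi y).
Proof.
split; first exact: phi_path.
by move=> i; rewrite size_mkseq => lt; rewrite nth_mkseq.
Qed.

Lemma ftgt_prefix n y : 0 < n -> ftgt bt (mkseq (phi y) n) = bo n.+1 (phi y n).
Proof.
case: n => // n _; rewrite /ftgt size_mkseq /= nth_mkseq //.
by case: (phi_path y n).
Qed.

(* The edges of the Schreier graph leaving a tail class of level [n] start at
   cylinders on which some generator is not a prefix replacement. *)
Lemma orbit_exit K (l : seq (A -> A)) n x y : K `<=` G -> K `<=` mon [set` l] ->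
  (forall s, s \in l -> K s) -> is_perm_group K ->
  0 < n -> tail_eq n x y -> infinite_set (orb rho K y) ->
  exists z, [/\ orb rho K y z, tail_eq n x z & exists2 s, s \in l &
    ~ is_prefrep_on bE bo bt (cnj (rho s)) (mkseq (phi z) n)].
Proof.
move=> KG Kl lK KK n0 xy inf; apply: contrapT => Hno; apply: inf.
apply: sub_finite_set (finite_tail_eq n x) => _ [k Kk <-].
suff [//] : tail_eq n x (rho k y) /\ K k.
elim: (Kl _ Kk) => [|s g /= sl _ [xg Kg]]; first by rewrite rho_id; split=> //; exact: grp_id.
have Ks := lK _ sl; split; last exact: grp_mul.
have [e [[_ se _] He]] : is_prefrep_on bE bo bt (cnj (rho s)) (mkseq (phi (rho g y)) n).
  apply: contrapT => bad; apply: Hno; exists (rho g y); split=> //.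
    by exists g.
  by exists s.
move=> i ni; rewrite (rhoM (KG _ Ks) (KG _ Kg)) /= xg //.
have := He _ (prefix_cyl n (rho g y)) i.
by rewrite /= psiK => ->; rewrite /prefrep size_mkseq ltnNge ni.
Qed.

(** The bounds of the single generators add up, each prefix being charged to a generator for which
    it is bad. *)
Lemma bad_prefixes_bounded (l : seq (A -> A)) : (forall s, s \in l -> G s) ->
  exists C, forall n v (t : seq (seq nat)), 1 <= n -> v < bV n -> uniq t ->
    (forall c, c \in t -> Lv bE bo bt n v c /\ exists2 s, s \in l &
      ~ is_prefrep_on bE bo bt (cnj (rho s)) c) -> size t <= C.
Proof.
elim: l => [|s l IH] lG.
  exists 0 => n v [|c t] // n0 vV _ Ht.
  by have [_ [s]] := Ht c (mem_head _ _).
have [|C HC] := IH; first by move=> t tl; apply: lG; rewrite inE tl orbT.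
have [_ [N HN]] := Hbounded (rhoH (lG s (mem_head _ _))).
exists (N + C) => n v t n0 vV ut Ht.
pose p c := `[< ~ is_prefrep_on bE bo bt (cnj (rho s)) c >].
rewrite -(count_predC p t) -!size_filter; apply: leq_add.
  apply: (HN n v) => //; first exact: filter_uniq.
  by move=> c; rewrite mem_filter => /andP[/asboolP bad /Ht [Lc _]].
apply: (HC n v) => //; first exact: filter_uniq.
move=> c; rewrite mem_filter => /andP[/negP ok /Ht [Lc [s' s'l bad]]].
split=> //; exists s' => //.
move: s'l; rewrite inE => /orP[/eqP e|//].
by exfalso; apply: ok; apply/asboolP; rewrite -e.
Qed.

(** Beyond some level [n] all points of [s] share the tail of [x]. By [orbit_exit] each orbit
    contains a point with this tail whose prefix of length [n] is bad for a generator. These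
    prefixes end at one vertex and differ for distinct orbits, so bounded type limits their
    number. *)
Lemma cofinal_orbits K : is_perm_group K -> K `<=` G -> fin_gen_mon K ->
  exists C, forall x (s : seq X), uniq s ->
    (forall y, y \in s -> cofinal x y /\ infinite_set (orb rho K y)) ->
    (forall y z, y \in s -> z \in s -> orb rho K y z -> y = z) -> size s <= C.
Proof.
move=> KK KG [S [finS SK KS]]; have [l Hl] := finite_set_seq finS.
have lK s : s \in l -> K s by move=> /Hl /SK.
have Kl : K `<=` mon [set` l].
  by move=> k /KS; apply: monS => s /Hl.
have [C HC] := bad_prefixes_bounded (fun s sl => KG _ (lK s sl)).
exists C => x s us s1 s2.
have [n [n0 Hn]] : exists n, 0 < n /\ forall y, y \in s -> tail_eq n x y.
  have {s2 us} : forall y, y \in s -> cofinal x y by move=> y /s1 [].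
  elim: (s) => [|y s' IH] Hs; first by exists 1.
  have [|n [n0 Hn]] := IH; first by move=> z zs; apply: Hs; rewrite inE zs orbT.
  have [m Hm] := Hs y (mem_head _ _); exists (maxn m n).
  split; first by rewrite leq_max n0 orbT.
  move=> z; rewrite inE => /orP[/eqP ->|/Hn Hz].
    exact: tail_eq_mono (leq_maxl _ _) Hm.
  exact: tail_eq_mono (leq_maxr _ _) Hz.
have /choice [ex Hex] : forall y, exists z, y \in s -> [/\ orb rho K y z, tail_eq n x z &
    exists2 t, t \in l & ~ is_prefrep_on bE bo bt (cnj (rho t)) (mkseq (phi z) n)].
  move=> y; case: (boolP (y \in s)) => [ys|_]; last by exists y.
  have [_ inf] := s1 _ ys.
  by have [z Hz] := orbit_exit KG Kl lK KK n0 (Hn _ ys) inf; exists z.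
rewrite -(size_map (fun y => mkseq (phi (ex y)) n)).
apply: (HC n (bo n.+1 (phi x n))) => //.
- case: Bdiag => _ _ Hb _ _; have [lt _] := phi_path x n.
  by have [] := Hb n.+1 (phi x n) isT lt.
- rewrite map_inj_in_uniq // => y z ys zs e.
  have [oy ty _] := Hex _ ys; have [oz tz _] := Hex _ zs.
  have eyz : ex y = ex z.
    apply: phi_inj => i.
    case: (ltnP i n) => lt; last by rewrite -ty // tz.
    by rewrite -(nth_mkseq 0 (phi (ex y)) lt) e nth_mkseq.
  apply: s2 => //; rewrite -eyz in oz.
  case: oy => k Kk ek; case: oz => k' Kk' ek'.
  exists (invf k' \o k); first by apply: grp_mul => //; exact: grp_inv.
  rewrite (rhoM (KG _ (grp_inv KK Kk')) (KG _ Kk)) /= ek -ek'.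
  by rewrite (rhoK GG rhoA) //; exact: KG.
- move=> c /mapP [y ys ->]; have [_ ty bad] := Hex _ ys; split=> //.
  split; [exact: prefix_fpath|exact: size_mkseq|].
  by rewrite ftgt_prefix // ty.
Qed.

(** Local finiteness leaves finitely many germs at [x] for the finitely generated image of [K]; the
    chosen germ representative separates cosets. *)
Lemma isotropy_fin_index x K : is_perm_group K -> K `<=` fixer G rho x -> fin_gen_mon K ->
  fin_index K (K `&` germ1 G rho x).
Proof.
move=> KK Kx [S [finS SK KS]]; have [l Hl] := finite_set_seq finS.
have KG : K `<=` G by move=> k /Kx [].
have [R HR] : exists R : list (X -> X), forall k, K k ->
    exists2 r, List.In r R & \forall y \near x, rho k y = r y.
  have [|R HR] := Hisotropy (phi_path x) (S := map rho l).
    move=> _ /In_mem /mapP [s /Hl /SK Ks ->]; split; first exact/rhoH/KG.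
    by move=> i; rewrite /= psiK; have [_ ->] := Kx _ Ks.
  exists R => k Kk; have [|r [rR [h [[_ [m Hm]] e]]]] := HR (rho k).
    suff [//] : gen_grp (fun s => List.In s (map rho l)) (rho k) /\ G k.
    elim: (KS _ Kk) => [|s g Ss _ [Hg Gg]].
      by rewrite rho_id; split; [exact: gen_id|exact: grp_id].
    have Gs := KG _ (SK _ Ss); split; last exact: grp_mul.
    rewrite rhoM //; apply: gen_mul => //; apply: gen_in.
    by apply/In_mem; apply: map_f; exact/Hl.
  exists r => //; have := phi_near x m; apply: filterS => y yx.
  rewrite e /=; congr r; apply: phi_inj => i.
  by have := Hm (phi y) (phi_path y) yx i; rewrite /= psiK.
pose f k := xget (@id X) [set r | List.In r R /\ \forall y \near x, rho k y = r y].
have fP k : K k -> List.In (f k) R /\ \forall y \near x, rho k y = f k y.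
  move=> /HR [r rR er].
  by apply: (@xgetPex _ (@id X) [set r | List.In r R /\ \forall y \near x, rho k y = r y]); exists r.
exists (X -> X), f; split.
  by apply: sub_finite_set (finite_set_In R) => _ [k /fP [? _] <-].
move=> g h Kg Kh e; have [Gg Gh] := (KG _ Kg, KG _ Kh); have Gg' := grp_inv GG Gg.
split; first by apply: grp_mul => //; exact: grp_inv.
split; first exact: grp_mul.
have [_ eg] := fP _ Kg; have [_ eh] := fP _ Kh; rewrite -e in eh.
apply: filterS2 eg eh => y eg eh.
by rewrite rhoM //= eh -eg (rhoK GG rhoA).
Qed.

End BratteliActions.

(** * Rays in the essential support *)

Lemma closureNP (X : topologicalType) (M : set X) (x : X) :
  ~ closure M x <-> \forall y \near x, ~ M y.
Proof.
split=> [|nM cM]; last by have [y [My]] := cM _ nM; apply.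
move/existsNP => [B /not_implyP [nB MB]]; apply: filterS nB => y By My.
by apply: MB; exists y.
Qed.

Section Realization.
Variables (deg : seq nat -> nat) (G : (vert deg -> vert deg) -> Prop).
Notation V := (vert deg).
Variables (X : topologicalType) (rho : (V -> V) -> (X -> X)) (cof : X -> X -> Prop).
Hypothesis branchG : fg_branch_group G.
Hypothesis rhoT : tame_action G rho cof.

Let rhoA := tame_action_action rhoT.
Let rho_id := action_id rhoA.
Let rhoM := actionM rhoA.

Let GG : is_perm_group G. Proof. by case: branchG. Qed.

Let Gaut g : G g -> is_aut g. Proof. by case: branchG => _ + _ _ _; apply. Qed.

Let Gtrans (u w : V) : size (val u) = size (val w) -> exists2 g, G g & g u = w.
Proof. by case: branchG => _ _ _ + _; apply. Qed.

Let Gindex n : 0 < n -> fin_index G (rist_n G n).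
Proof.
move=> n0; case: branchG => _ _ _ _ /(_ n n0).
by apply: fin_indexP => //; [exact: rist_n_perm|exact: rist_n_sub].
Qed.

Notation R v := (rist_v G v).

Let R_perm v : is_perm_group (R v) := rist_perm GG v.
Let R_sub v : R v `<=` G := @rist_sub _ G v.

Let R_fin_gen v : 0 < size (val v) -> fin_gen_mon (R v).
Proof.
move=> v0; apply: (rist_fin_gen GG erefl).
apply: (schreier_fin_gen GG (rist_n_perm GG _) (@rist_n_sub _ _ GG _)).
  by apply: fin_gen_monP => //; case: branchG.
exact: Gindex.
Qed.

Let R_commuting u w : size (val u) = size (val w) -> u <> w -> commuting (R u) (R w).
Proof.
by move=> e ne g h rg rh; apply/funext => z; exact: (rist_level_comm GG z e ne rg rh).
Qed.

Definition rist_supp x (v : V) : Prop := supp rho (derived (R v)) x.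

Lemma rist_suppN x v : (\forall y \near x, forall k, derived (R v) k -> rho k y = y) ->
  ~ rist_supp x v.
Proof.
by move=> nf; apply/closureNP; apply: filterS nf => y e [k [Dk]]; apply; exact: e.
Qed.

Lemma rist_supp_nontriv x v : rist_supp x v -> exists2 g, R v g & exists z, g z <> z.
Proof.
move=> /(_ setT filterT) [y [[k [Dk ky]] _]].
exists k; first exact: (derived_sub (R_perm v) (fun g Hg => Hg) Dk).
apply: contrapT => nz; apply: ky.
have -> : k = id; last by rewrite rho_id.
by apply/funext => z; apply: contrapT => ne; apply: nz; exists z.
Qed.

Lemma rist_supp_pre x u w : pre u w -> rist_supp x w -> rist_supp x u.
Proof.
move=> puw Sw B nB; have [y [[k [Dk ky]] By]] := Sw B nB.
exists y; split=> //; exists k; split=> //.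
exact: (derivedS (rist_mono puw)).
Qed.

Lemma rist_supp_equiv x u g : G g -> rist_supp x u -> rist_supp (rho g x) (g u).
Proof.
move=> Gg Su B nB; have Gg' := grp_inv GG Gg.
have [y [[k [Dk ky]] By]] := Su _ (tame_cont rhoT Gg nB).
exists (rho g y); split=> //; exists (g \o k \o invf g); split.
  by apply: (derived_conj GG (@R_sub u) Gg) Dk => a; exact: rist_conjV.
have Gk : G k := derived_sub GG (@R_sub u) Dk.
rewrite (rhoM (grp_mul GG Gg Gk) Gg') (rhoM Gg Gk) /= (rhoK GG rhoA Gg).
by move/(can_inj (rhoK GG rhoA Gg)).
Qed.

(** An element of [Rist(n)'] is the product of its components in the groups [Rist(u)']. If [x] is
    outside the finitely many supports of these, a neighbourhood is fixed by all of them. *)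
Lemma supp_level x n : supp rho (derived (rist_n G n)) x ->
  exists2 u, size (val u) = n & rist_supp x u.
Proof.
move=> Sx; apply: contrapT => Hno; move: Sx; apply/closureNP.
have [l _ Hl] := level_list deg n.
have : forall u, u \in l ->
    \forall y \near x, forall k, derived (R u) k -> rho k y = y.
  move=> u; rewrite Hl => /eqP su; have /closureNP : ~ rist_supp x u.
    by move=> Su; apply: Hno; exists u.
  apply: filterS => y nM k Dk; apply: contrapT => ne; apply: nM.
  by exists k.
move/near_seq; apply: filterS => y Hy [k [Dk]]; apply.
have Rk : rist_n G n k.
  exact: (derived_sub (rist_n_perm GG n) (fun g Hg => Hg) Dk).
suff [//] : fixer G rho y k.
have fy := fixer_perm GG rhoA y.
apply: (rist_n_ind GG Gaut Rk); first exact: grp_id.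
move=> v g sv Gg fg; apply: (grp_mul fy) => //.
have Dv := derived_restr GG sv Dk; split; first exact: (derived_sub GG (@R_sub v) Dv).
by apply: Hy Dv; rewrite Hl sv.
Qed.

(** Otherwise a normal finite index subgroup acts trivially near [x]. It moves some vertex of the
    ray, so by [rist_derived_sub] it contains the derived rigid stabilizer there, whose support
    contains [x]. *)
Lemma infinite_ray_orbit x (xi : bnd deg) n : (forall m, rist_supp x (bpref xi m)) ->
  0 < n -> infinite_set (orb rho (R (bpref xi n)) x).
Proof.
move=> Sxi n0 fin; set v := bpref xi n.
have fg : fin_gen_mon (R v) by apply: R_fin_gen; rewrite size_bpref.
have [K [KK KR Knorm iK Kfix]] := finite_orbit_fixed GG rhoT (R_perm v) (@R_sub v) fg fin.
have nt m := rist_supp_nontriv (Sxi m).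
have [a Ka [m am]] := fin_index_moves_ray GG Gaut Gtrans nt (Gindex n0) KK KR iK.
have nm : n <= m.
  rewrite leqNgt; apply/negP => lt; apply: am.
  by apply: (rist_fix GG Gaut (KR _ Ka)); rewrite !size_bpref ltnW.
apply: (rist_suppN _ (Sxi m)).
apply: filterS Kfix => y Hy k Dk; apply: Hy; move: Dk.
apply: (rist_derived_sub GG Gaut KK _ _ Ka am).
  by move=> k' /KR; exact: R_sub.
by move=> g k' rg Kk'; apply: Knorm => //; exact: (rist_mono (pre_bpref xi nm)).
Qed.

(** Take [a] in [K] moving the [l]-th vertex and [c] in [K], supported below that vertex, moving the
    [p]-th one. Since [a] carries the subtree off itself, the commutator of [a] and [c] acts on the
    [p]-th vertex as [c] does. *)
Lemma derived_moves_ray (xi : bnd deg) m (K : set (V -> V)) :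
  (forall m, exists2 g, R (bpref xi m) g & exists z, g z <> z) -> 0 < m ->
  is_perm_group K -> K `<=` R (bpref xi m) -> fin_index (R (bpref xi m)) K ->
  exists2 c, derived K c & exists2 p, m <= p & c (bpref xi p) <> bpref xi p.
Proof.
move=> nt m0 KK KR iK.
have [a Ka [l al]] := fin_index_moves_ray GG Gaut Gtrans nt (Gindex m0) KK KR iK.
have Ra := KR _ Ka; have Ga := R_sub Ra.
have ml : m <= l.
  rewrite leqNgt; apply/negP => lt; apply: al.
  by apply: (rist_fix GG Gaut Ra); rewrite !size_bpref ltnW.
have Rl := R_perm (bpref xi l).
have RlR : R (bpref xi l) `<=` R (bpref xi m) := rist_mono (pre_bpref xi ml).
have l0 : 0 < l := leq_trans m0 ml.
have [c [Kc Rc] [p cp]] : exists2 c, (K `&` R (bpref xi l)) c &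
    exists p, c (bpref xi p) <> bpref xi p.
  apply: (fin_index_moves_ray GG Gaut Gtrans nt (Gindex l0)).
  - exact: perm_groupI.
  - exact: subIsetr.
  - exact: (fin_index_sub Rl RlR iK).
have lp : l <= p.
  rewrite leqNgt; apply/negP => lt; apply: cp.
  by apply: (rist_fix GG Gaut Rc); rewrite !size_bpref ltnW.
exists (invf a \o invf c \o a \o c); first by apply: (derived_comm KK _ Ka Kc).
exists p; first exact: leq_trans ml lp.
have Rc' := grp_inv Rl Rc.
rewrite /= (rist_out Rc') ?(invfK GG) //.
have pc : pre (bpref xi l) (c (bpref xi p)) by rewrite (rist_pre GG _ Rc) pre_bpref.
rewrite -(aut_pre (Gaut Ga)) in pc.
apply/negP => pl; apply: al; apply: pre_eq pc pl.
by rewrite (aut_size (Gaut Ga)).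
Qed.

(* If [Rist(xi_n)] and [Rist(eta_n)] both have infinite orbits at [x], an element
   of the first moving [xi] and agreeing at [x] with an element of the second
   produces a third, commuting, rigid stabilizer with infinite orbit at [x]. *)
Lemma ray_unique x (xi eta : bnd deg) : (forall m, rist_supp x (bpref xi m)) ->
  (forall m, rist_supp x (bpref eta m)) -> proj1_sig xi = proj1_sig eta.
Proof.
move=> Sxi Seta; apply/funext => i; apply: contrapT => ne.
set n := i.+1; have n0 : 0 < n by [].
have ne_n : bpref xi n <> bpref eta n.
  move=> /(congr1 (fun u => nth 0 (val u) i)) /=.
  by rewrite !nth_mkseq.
have nt m := rist_supp_nontriv (Sxi m).
pose A := R (bpref xi n); pose B := R (bpref eta n).
have Ap : is_perm_group A := R_perm _; have Bp : is_perm_group B := R_perm _.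
have AG : A `<=` G := @R_sub _; have BG : B `<=` G := @R_sub _.
have szn : size (val (bpref xi n)) = size (val (bpref eta n)) by rewrite !size_bpref.
have cAB : commuting A B by exact: R_commuting.
have fA : fin_gen_mon A by apply: R_fin_gen; rewrite size_bpref.
have fB : fin_gen_mon B by apply: R_fin_gen; rewrite size_bpref.
have infB : infinite_set (orb rho B x) by exact: infinite_ray_orbit.
have iM := fin_index_meets GG rhoT Ap Bp AG BG cAB fA fB infB.
have Mp := meets_perm GG rhoA x Ap Bp AG BG cAB.
have [a [Aa [b Bb ab]] [m am]] := fin_index_moves_ray GG Gaut Gtrans nt (Gindex n0)
  Mp (fun k Mk => proj1 Mk) iM.
have [Ga Gb] := (AG _ Aa, BG _ Bb).
have Ga' := grp_inv GG Ga; have Gb' := grp_inv GG Gb.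
have nm : n <= m.
  rewrite leqNgt; apply/negP => lt; apply: am.
  by apply: (rist_fix GG Gaut Aa); rewrite !size_bpref ltnW.
have m0 : 0 < m := leq_trans n0 nm.
set v := bpref xi m in am; pose u := invf a v.
have su : size (val u) = size (val v) by exact: aut_size (Gaut Ga') v.
have vu : v <> u.
  by move=> e; apply: am; rewrite {1}e (invfKV GG).
have au : a u = v by exact: (invfKV GG).
have pv : pre (bpref xi n) v := pre_bpref xi nm.
have pu : pre (bpref xi n) u.
  by rewrite /u (rist_pre GG _ (grp_inv Ap Aa)).
have RvA : R v `<=` A := rist_mono pv.
have RuA : R u `<=` A := rist_mono pu.
have cvu : commuting (R v) (R u) by exact: R_commuting.
have cvB : commuting (R v) B by move=> k l /RvA Ak Bl; exact: cAB.
have cuB : commuting (R u) B by move=> k l /RuA Ak Bl; exact: cAB.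
have v0 : 0 < size (val v) by rewrite size_bpref.
have infv : infinite_set (orb rho (R v) x) by exact: infinite_ray_orbit.
(* For [k] in [Rist(v)], [a x = b x] gives [b^-1 a (a^-1 k a) x = b^-1 k b x = k x], so [b^-1 a]
   maps the orbit of [Rist(u)] onto a set containing that of [Rist(v)]. *)
have infu : infinite_set (orb rho (R u) x).
  apply: contra_not infv => fin.
  apply: sub_finite_set (finite_image (rho (invf b \o a)) fin) => _ [k Rk <-].
  have Gk := R_sub Rk; have Ru : R u (invf a \o k \o a).
    by apply: (rist_conj GG Gaut) => //; rewrite au.
  exists (rho (invf a \o k \o a) x); first by exists (invf a \o k \o a).
  rewrite (rhoM (grp_mul GG Ga' Gk) Ga) (rhoM Ga' Gk) (rhoM Gb' Ga) /=.
  rewrite (rhoKV GG rhoA Ga) ab.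
  by rewrite (rho_commute rhoA _ Gk Gb (cAB _ _ (RvA _ Rk) Bb)) (rhoK GG rhoA Gb).
have fv : fin_gen_mon (R v) := R_fin_gen v0.
have fu : fin_gen_mon (R u) by apply: R_fin_gen; rewrite su.
have [K [KK KR Knorm iK Kfix]] := three_commuting GG rhoT (R_perm v) (R_perm u) Bp
  (@R_sub v) (@R_sub u) BG cvu cvB cuB fv fu fB infu infB.
(* [K'] is trivial near [x] and moves the ray at level [p], so it contains the derived rigid
   stabilizer of that vertex, contradicting that [x] is in its support. *)
have [c Dc [p mp cp]] := derived_moves_ray nt m0 KK KR iK.
apply: (rist_suppN _ (Sxi p)).
apply: filterS Kfix => y Hy k Dk; apply: Hy; move: Dk.
have KG : K `<=` G by move=> k' /KR; exact: R_sub.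
apply: (rist_derived_sub GG Gaut (derived_perm GG KG) (derived_sub GG KG) _ Dc cp).
move=> g k' rg Dk'.
have Rg : R v g by apply: (rist_mono (pre_bpref xi mp)).
have Gg := R_sub Rg; have Gg' := grp_inv GG Gg.
rewrite -{2}(invfV GG Gg); apply: (derived_conj GG KG Gg') Dk' => h Kh.
by rewrite (invfV GG Gg); exact: Knorm.
Qed.

(** * Existence, equivariance and continuity of the ray map *)

Lemma ess_supp_ray x : ess_supp G rho x -> exists xi : bnd deg,
  forall m, rist_supp x (bpref xi m).
Proof.
move=> Yx; apply: koenig => [u w|m]; first exact: rist_supp_pre.
(* The essential support only speaks of levels [n >= 1], so level [m+1] is used and truncated to
   reach the root as well. *)
have [w sw Sw] := supp_level (Yx m.+1 isT).
exists (trunc m w); first by rewrite size_trunc // sw.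
exact: rist_supp_pre (pre_trunc m w) Sw.
Qed.

Lemma ray_ess_supp x (xi : bnd deg) : (forall m, rist_supp x (bpref xi m)) ->
  ess_supp G rho x.
Proof.
move=> Sxi n _ B nB; have [y [[k [Dk ky]] By]] := Sxi n B nB.
exists y; split=> //; exists k; split=> //.
by apply: derivedS Dk; apply: rist_sub_n; exact: size_bpref.
Qed.

Lemma bact_ray (xi : bnd deg) g : G g -> exists2 eta : bnd deg,
  proj1_sig eta = bact g xi & forall m, bpref eta m = g (bpref xi m).
Proof.
move=> /Gaut Ag.
have e m : mkseq (bact g xi) m = val (g (bpref xi m)).
  apply: (@eq_from_nth _ 0); first by rewrite size_mkseq (aut_size Ag) size_bpref.
  move=> i; rewrite size_mkseq => lt; rewrite nth_mkseq // /bact.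
  by rewrite -(trunc_bpref xi lt) (aut_trunc Ag) /= nth_take.
have vb m : vertex deg (mkseq (bact g xi) m) by rewrite e; exact: valP.
by exists (exist _ (bact g xi) vb) => // m; apply: val_inj; exact: e.
Qed.

(** At a deep enough level [m], all vertices whose support contains [x] lie below [v]. The other
    vertices of the level are finitely many and their supports closed, so nearby points avoid them
    too and have rays through [v]. *)
Lemma ray_continuous x (xi : bnd deg) n : (forall m, rist_supp x (bpref xi m)) ->
  \forall y \near x, forall eta : bnd deg, (forall m, rist_supp y (bpref eta m)) ->
    bpref eta n = bpref xi n.
Proof.
move=> Sxi; set v := bpref xi n.
have [m Hm] : exists m, forall w : V, size (val w) = m -> rist_supp x w -> pre v w.
  (* Failing this at every level, [koenig] produces a ray of [x] avoiding [v], against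
     uniqueness. *)
  apply: contrapT => Hno.
  have [eta Heta] : exists eta : bnd deg, forall m,
      rist_supp x (bpref eta m) /\ ~~ pre v (bpref eta m).
    apply: (koenig (P := fun w => rist_supp x w /\ ~~ pre v w)) => [u w puw [Sw npw]|m].
      split; first exact: rist_supp_pre Sw.
      by apply: contra npw => pvu; exact: pre_trans pvu puw.
    apply: contrapT => Hm; apply: Hno; exists m => w sw Sw.
    by apply: contraT => npw; exfalso; apply: Hm; exists w.
  have e : proj1_sig eta = proj1_sig xi.
    by apply: ray_unique => // m; case: (Heta m).
  have [_] := Heta n; rewrite (_ : bpref eta n = v) ?pre_refl //.
  by apply: val_inj; rewrite /= e.
have [l _ Hl] := level_list deg m.
have : forall w, w \in l -> \forall y \near x, ~~ pre v w -> ~ rist_supp y w.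
  move=> w; rewrite Hl => /eqP sw; case: (boolP (pre v w)) => pw; first by apply: nearW.
  have /closureNP /nbhs_interior nS : ~ rist_supp x w.
    by move=> Sw; rewrite (Hm _ sw Sw) in pw.
  by apply: filterS nS => y ny _; apply/closureNP.
move/near_seq; apply: filterS => y Hy eta Seta.
have pw : pre v (bpref eta m).
  apply: contraT => npw; exfalso; apply: (Hy (bpref eta m) _ npw (Seta m)).
  by rewrite Hl size_bpref.
have nm := pre_size pw; rewrite !size_bpref in nm.
by move/preP: pw; rewrite size_bpref trunc_bpref.
Qed.

Lemma tame_realization : tree_infinite deg -> exists q : X -> bnd deg,
  cont_to_bnd (ess_supp G rho) q /\
  forall g y, G g -> ess_supp G rho y -> proj1_sig (q (rho g y)) = bact g (q y).
Proof.
move=> /bnd_inhabited [xi0 _].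
(* Outside the essential support the value is the arbitrary ray [xi0]. *)
have /choice [q Hq] : forall x, exists xi : bnd deg, ess_supp G rho x ->
    forall m, rist_supp x (bpref xi m).
  move=> x; case: (pselect (ess_supp G rho x)) => [/ess_supp_ray [xi Hxi]|nY].
    by exists xi.
  by exists xi0.
exists q; split=> [y Yy n|g y Gg Yy].
  have near_y := ray_continuous n (Hq _ Yy).
  exists [set y' | forall eta : bnd deg, (forall m, rist_supp y' (bpref eta m)) ->
    bpref eta n = bpref (q y) n] => // y' Uy' Yy' i lt.
  have := congr1 (fun u => nth 0 (val u) i) (Uy' _ (Hq _ Yy')).
  by rewrite /= !nth_mkseq.
have [eta <- Heta] := bact_ray (q y) Gg.
(* The translate by [g] of the ray of [y] is a ray of [g y]; uniqueness identifies it with the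
   chosen one. *)
have Sg m : rist_supp (rho g y) (bpref eta m).
  by rewrite Heta; apply: rist_supp_equiv => //; exact: Hq.
by apply: ray_unique => //; apply: Hq; exact: ray_ess_supp Sg.
Qed.

End Realization.

Theorem theorem6p32 (deg : seq nat -> nat) (G : (vert deg -> vert deg) -> Prop)
  (X : topologicalType) (H : (X -> X) -> Prop)
  (rho : (vert deg -> vert deg) -> (X -> X)) :
  tree_infinite deg ->
  fg_branch_group G ->
  compact [set: X] -> totally_disconnected [set: X] ->
  is_perm_group H -> (forall h, H h -> homeo h) -> strongly_bounded H ->
  (forall g, G g -> H (rho g)) ->
  (forall g1 g2, G g1 -> G g2 -> rho (g1 \o g2) = rho g1 \o rho g2) ->
  (forall g1 g2, G g1 -> G g2 -> rho g1 = rho g2 -> g1 = g2) ->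
  exists q : X -> bnd deg,
    cont_to_bnd (ess_supp G rho) q /\
    forall g y, G g -> ess_supp G rho y ->
      proj1_sig (q (rho g y)) = bact g (q y).
Proof.
move=> Tinf branchG _ _ _ Hhomeo strongH rhoH rhoM _.
have GG : is_perm_group G by case: branchG.
(* [rho id] is idempotent and, as a homeomorphism, injective. *)
have rho_id : rho id = id.
  have Gid := grp_id GG; have [h [hK _ _ _]] := Hhomeo _ (rhoH _ Gid).
  apply/funext => x; apply: (can_inj hK).
  by have /(congr1 (@^~ x)) := rhoM _ _ Gid Gid.
have rhoA : action G rho by [].
case: strongH => bV [bE [bo [bt [phi [psi []]]]]].
move=> Bdiag [phi_path psiK phiK phi_near psi_near] Hbounded Hiso.
apply: (@tame_realization _ _ _ _ (cofinal phi)) => //; split=> //.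
- by move=> g /rhoH /Hhomeo [h []].
- exact: cofinal_refl.
- exact: cofinal_trans.
- exact: (cofinal_regular rhoH phi_path psiK Hbounded).
- exact: (fixed_regular rhoH phi_path psiK phi_near Hbounded).
- exact: (cofinal_orbits GG rhoA rhoH Bdiag phi_path psiK Hbounded).
- exact: (isotropy_fin_index GG rhoA rhoH phi_path psiK phi_near Hiso).
Qed.
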